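(* Let $\kappa$ be a regular cardinal and $\mu>\kappa$ a cardinal with $\mu^*=\operatorname{cf}(\mu)<\kappa$. Then $\Box^{***}_{\kappa,\mu}$ holds if and only if there is a weak $(\kappa,\mu)$-Jensen matrix over some $x$ (equivalently, for every sufficiently large $\chi$ and every $x\in\mathcal{H}(\chi)$ there is a weak $(\kappa,\mu)$-Jensen matrix over $x$).
   Context: $\mathcal{H}(\chi)$ is the set of sets hereditarily of cardinality $<\chi$; $[X]^{<\kappa}=\{Y\subseteq X:|Y|<\kappa\}$. $\Box^{***}_{\kappa,\mu}$ (for $\kappa$ regular, $\mu>\kappa$): there are a sequence $(C_\alpha)_{\alpha<\mu^+}$ and a club $D\subseteq\mu^+$ such that for every $\alpha\in D$ with $\operatorname{cf}(\alpha)\geq\kappa$: $C_\alpha\subseteq\alpha$ is unbounded in $\alpha$, and every $x\in[C_\alpha]^{<\kappa}$ is a subset of some $C_{\alpha'}$ with $\alpha'<\alpha$ and $|C_{\alpha'}|<\kappa$. A weak $(\kappa,\mu)$-Jensen matrix over $x\in\mathcal{H}(\chi)$ is a sequence $(M_{\alpha,\beta})_{\alpha<\mu^+,\beta<\mu^*}$ such that: (j1) each $M_{\alpha,\beta}$ is an elementary submodel of $(\mathcal{H}(\chi),\in)$, $x\in M_{\alpha,\beta}$, $\kappa+1\subseteq M_{\alpha,\beta}$ and $|M_{\alpha,\beta}|<\mu$; (j2) for each $\alpha$, $(M_{\alpha,\beta})_{\beta<\mu^*}$ is increasing; letting $M_\alpha=\bigcup_{\beta<\mu^*}M_{\alpha,\beta}$: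 (j3$^-$) if $\alpha<\mu^+$ and $\operatorname{cf}(\alpha)\geq\kappa$, then there is $\beta^*<\mu^*$ such that for every $\beta$ with $\beta^*\leq\beta<\mu^*$, $[M_{\alpha,\beta}]^{<\kappa}\cap M_{\alpha}$ is cofinal in $([M_{\alpha,\beta}]^{<\kappa},\subseteq)$; (j4) $(M_\alpha)_{\alpha<\mu^+}$ is continuously increasing and $\mu^+\subseteq\bigcup_{\alpha<\mu^+}M_\alpha$. *)

(* Defs.v *)
From HB Require Import structures.
From mathcomp Require Import all_boot all_classical.

Set Implicit Arguments.
Unset Strict Implicit.
Unset Printing Implicit Defensive.

Local Open Scope classical_set_scope.
Local Open Scope card_scope.

(* [V] is Aczel's type of well-founded trees modulo bisimilarity.  With the
   classical axioms of [boolp], [(V, memV)] is a model of ZFC, in which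
   separation and replacement hold for arbitrary predicates and functions. *)

Inductive tree : Type := Node (I : Type) of I -> tree.

Fixpoint bisim (s t : tree) : Prop :=
  match s, t with
  | Node A f, Node B g =>
      (forall i, exists j, bisim (f i) (g j)) /\
      (forall j, exists i, bisim (f i) (g j))
  end.

Definition V : Type := {c : set tree | exists t, c = bisim t}.

Definition class (t : tree) : V := exist _ (bisim t) (ex_intro _ t erefl).

Definition memV (x y : V) : Prop :=
  exists I (f : I -> tree) (i : I), x = class (f i) /\ y = class (Node f).

Notation "x ∈ y" := (memV x y) (at level 70, no associativity).

(* A set is coerced to the class of its elements, so that [x `<=` y] is
   inclusion and [x #<= y] is [|x| <= |y|]. *)
Definition elts (x : V) : set V := [set y | y ∈ x].
Coercion elts : V >-> set.

Definition emptyV : V := class (Node (fun e : False => match e with end)).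

HB.instance Definition _ := gen_eqMixin V.
HB.instance Definition _ := gen_choiceMixin V.
HB.instance Definition _ := isPointed.Build V emptyV.

Lemma bisim_refl t : bisim t t.
Proof. by elim: t => I f IH /=; split=> i; exists i. Qed.

Lemma bisim_sym s t : bisim s t -> bisim t s.
Proof.
elim: s t => I f IH [J g] /= [fg gf]; split=> k.
- by have [i /IH ?] := gf k; exists i.
- by have [j /IH ?] := fg k; exists j.
Qed.

Lemma bisim_trans s t u : bisim s t -> bisim t u -> bisim s u.
Proof.
elim: s t u => I f IH [J g] [K h] /= [fg gf] [gh hg]; split=> k.
- by have [j fj] := fg k; have [l jl] := gh j; exists l; apply: IH jl.
- by have [j jk] := hg k; have [i ij] := gf j; exists i; apply: IH jk.
Qed.

Lemma class_eq s t : class s = class t <-> bisim s t.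
Proof.
split=> [/(congr1 sval) /= ->|st]; first exact: bisim_refl.
apply: eq_exist; apply/funext => u; apply/propext; split; apply: bisim_trans => //.
exact: bisim_sym.
Qed.

Lemma classP x : exists t, x = class t.
Proof. by case: x => c ct; have [t ctE] := ct; exists t; apply: eq_exist. Qed.

Lemma mem_Node x I (f : I -> tree) :
  x ∈ class (Node f) <-> exists i, x = class (f i).
Proof.
split=> [[J [g [j [-> /class_eq [_ /(_ j) [i ij]]]]]]|[i ->]].
  by exists i; apply/class_eq/bisim_sym.
by exists I, f, i.
Qed.

Lemma V_ext (x y : V) : (forall z, z ∈ x <-> z ∈ y) -> x = y.
Proof.
have [[I f] ->] := classP x; have [[J g] ->] := classP y => xy.
apply/class_eq; split=> k.
  have /xy/mem_Node[j /class_eq] : class (f k) ∈ class (Node f)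
    by apply/mem_Node; exists k.
  by exists j.
have /xy/mem_Node[i /class_eq/bisim_sym] : class (g k) ∈ class (Node g)
  by apply/mem_Node; exists k.
by exists i.
Qed.

Lemma mem_wf : well_founded memV.
Proof.
move=> x; have [t ->] := classP x; elim: t {x} => I f IH.
by constructor=> y /mem_Node[i ->].
Qed.

(* The elements of [V] are exactly the ranges of small families. *)
Lemma V_range I (f : I -> V) : exists x, forall y, y ∈ x <-> exists i, y = f i.
Proof.
have [g fg] := choice (fun i => classP (f i)).
exists (class (Node g)) => y.
by split=> [/mem_Node|] [i ->]; [|apply/mem_Node]; exists i; rewrite fg.
Qed.

Lemma V_small (x : V) :
  exists I (f : I -> V), forall y, y ∈ x <-> exists i, y = f i.
Proof.
have [[I f] ->] := classP x.
by exists I, (class \o f) => y; apply: mem_Node.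
Qed.

(* Von Neumann ordinals: [α < β] is [α ∈ β] and [α <= β] is [α `<=` β]. *)

Definition transitive_class (A : set V) : Prop :=
  forall y : V, A y -> y `<=` A.

(* Well-foundedness of membership is [mem_wf]. *)
Definition is_ordinal (a : V) : Prop :=
  transitive_class a /\
  (forall x y z : V, x ∈ a -> y ∈ a -> z ∈ a -> x ∈ y -> y ∈ z -> x ∈ z) /\
  (forall x y : V, x ∈ a -> y ∈ a -> x ∈ y \/ x = y \/ y ∈ x).

Definition is_limit (a : V) : Prop :=
  is_ordinal a /\ (exists x, x ∈ a) /\
  forall x, x ∈ a -> exists y, y ∈ a /\ x ∈ y.

(* The least ordinal satisfying [P] ([emptyV] if there is none). *)
Definition least (P : set V) : V :=
  get [set a | is_ordinal a /\ P a /\ forall x, x ∈ a -> ~ P x].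

Definition unbounded_in (A : set V) (a : V) : Prop :=
  forall x, x ∈ a -> exists y : V, A y /\ y ∈ a /\ x `<=` y.

Definition cof (a : V) : V :=
  least [set c | is_ordinal c /\ exists f : V -> V,
                   (forall i, i ∈ c -> f i ∈ a) /\ unbounded_in (f @` c) a].

Definition card_lt (A B : set V) : Prop := A #<= B /\ ~ (B #<= A).

Definition cardinal (k : V) : Prop :=
  is_ordinal k /\ forall x : V, x ∈ k -> card_lt x k.

Definition regular (k : V) : Prop :=
  cardinal k /\ infinite_set k /\ cof k = k.

Definition succ_cardinal (m : V) : V :=
  least [set n | cardinal n /\ m ∈ n].

Definition transitive_closure (x : V) : set V := smallest transitive_class x.

Definition H (chi : V) : set V :=
  [set x | card_lt (transitive_closure x) chi].

Definition small_subsets (kappa : V) (X : set V) : set V :=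
  [set Y : V | Y `<=` X /\ card_lt Y kappa].

Definition cofinal_in (F G : set V) : Prop :=
  F `<=` G /\ forall y : V, G y -> exists z : V, F z /\ y `<=` z.

Definition club (D : set V) (l : V) : Prop :=
  D `<=` l /\ unbounded_in D l /\
  forall d : V, d ∈ l -> is_limit d -> unbounded_in (D `&` d) d -> D d.

Inductive formula : Type :=
| FMem of nat & nat
| FEq of nat & nat
| FNot of formula
| FAnd of formula & formula
| FAll of nat & formula.

Fixpoint sat (A : set V) (v : nat -> V) (phi : formula) : Prop :=
  match phi with
  | FMem i j => v i ∈ v j
  | FEq i j => v i = v j
  | FNot p => ~ sat A v p
  | FAnd p q => sat A v p /\ sat A v q
  | FAll i p => forall a, A a -> sat A [eta v with i |-> a] p
  end.

Definition elementary_submodel (A B : set V) : Prop :=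
  A !=set0 /\ A `<=` B /\
  forall (phi : formula) (v : nat -> V), (forall n, A (v n)) ->
    (sat A v phi <-> sat B v phi).

(* Sequences are Coq functions, of which only the values at the indices in
   the intended range matter. *)
Definition weak_square (kappa mu : V) : Prop :=
  exists (C : V -> V) (D : set V),
    club D (succ_cardinal mu) /\
    forall alpha : V, D alpha -> kappa `<=` cof alpha ->
      C alpha `<=` alpha /\
      unbounded_in (C alpha) alpha /\
      forall x : V, small_subsets kappa (C alpha) x ->
        exists alpha' : V,
          alpha' ∈ alpha /\ x `<=` C alpha' /\ card_lt (C alpha') kappa.

Definition row_union (mu : V) (M : V -> V -> V) (alpha : V) : set V :=
  \bigcup_(beta in cof mu) M alpha beta.

Definition weak_jensen_matrix (kappa mu chi x : V) (M : V -> V -> V) : Prop :=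
  [/\ forall alpha beta : V, alpha ∈ succ_cardinal mu -> beta ∈ cof mu ->
        elementary_submodel (M alpha beta) (H chi) /\
        x ∈ M alpha beta /\
        kappa `|` [set kappa] `<=` M alpha beta /\
        card_lt (M alpha beta) mu,
      forall alpha beta beta' : V, alpha ∈ succ_cardinal mu ->
        beta ∈ cof mu -> beta' ∈ cof mu -> beta `<=` beta' ->
        M alpha beta `<=` M alpha beta',
      forall alpha : V, alpha ∈ succ_cardinal mu -> kappa `<=` cof alpha ->
        exists2 beta0 : V, beta0 ∈ cof mu &
          forall beta : V, beta ∈ cof mu -> beta0 `<=` beta ->
            cofinal_in
              (small_subsets kappa (M alpha beta) `&` row_union mu M alpha)
              (small_subsets kappa (M alpha beta))
    & [/\ forall alpha alpha' : V, alpha ∈ succ_cardinal mu ->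
            alpha' ∈ succ_cardinal mu -> alpha `<=` alpha' ->
            row_union mu M alpha `<=` row_union mu M alpha',
          forall alpha : V, alpha ∈ succ_cardinal mu -> is_limit alpha ->
            row_union mu M alpha =
            \bigcup_(alpha' in alpha) row_union mu M alpha'
        & succ_cardinal mu `<=`
            \bigcup_(alpha in succ_cardinal mu) row_union mu M alpha]].

(* Main.v *)
Require Import Defs.
From mathcomp Require Import all_boot all_classical.
From mathcomp Require wochoice.

(* From a matrix to the square: there are at most [mu^+] sets in the rows
   [M_a], and for a in a club the sets listed before stage [a] are exactly those
   of [M_a], while [M_a] has the same ordinals below [mu^+] as [a].  If
   [cf a >= kappa > cf mu], some column [M_(a,b)] is unbounded in [a], and
   [C_a = M_(a,b) `&` a] works: its small subsets are covered by small members
   of [M_a], which were listed earlier.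

   From the square to a matrix: build a continuous chain of elementary submodels
   [M_a] of size at most [mu], each with an enumeration by [mu].  If
   [cf a >= kappa], take [M_(a,b)] to be the hull of [nu_b] and a short cofinal
   subset of [C_a] under Skolem functions and the enumerations of the sets [C_a']
   and of the stages below [a], where [nu_b] increases to [mu].  A small subset of
   [M_(a,b)] lies in the hull of a small set of generators; these are covered by
   some [C_a'] with [a' < a] and by one of [mu] many subsets of [nu_b] (obtained
   from the square at a point of large cofinality), and since the hull is bounded
   in [a], it can be computed from the stages below some [e < a].  Hence the hull
   of the cover is put into [M_(e+1)], thus into [M_a], by construction. *)

Set Implicit Arguments.
Unset Strict Implicit.
Unset Printing Implicit Defensive.

Local Open Scope classical_set_scope.
Local Open Scope card_scope.

(** * Sets among classes *)

Definition small (A : set V) : Prop := exists x : V, elts x = A.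

(* [emptyV] if [A] is a proper class. *)
Definition mkV (A : set V) : V := get [set x : V | elts x = A].

Lemma mkVE A : small A -> elts (mkV A) = A.
Proof. by move=> sA; rewrite /mkV; have := getPex sA. Qed.

Lemma mkVP A x : small A -> (x ∈ mkV A) <-> A x.
Proof. by move=> sA; rewrite -[x ∈ _]/(elts _ x) mkVE. Qed.

Lemma elts_inj (x y : V) : elts x = elts y -> x = y.
Proof. by move=> xy; apply: V_ext => z; rewrite -[z ∈ x]/(elts x z) xy. Qed.

Lemma small_elts (x : V) : small x. Proof. by exists x. Qed.

Lemma mkV_elts (x : V) : mkV x = x.
Proof. by apply: elts_inj; rewrite mkVE //; exact: small_elts. Qed.

Lemma small_range I (f : I -> V) : small (range f).
Proof.
have [x xf] := V_range f; exists x; apply/seteqP; split=> y.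
  by move=> /xf[i ->]; exists i.
by move=> [i _ <-]; apply/xf; exists i.
Qed.

Lemma small_image (f : V -> V) (x : V) : small (f @` x).
Proof.
have [I [g gP]] := V_small x; have [y yE] := small_range (f \o g).
exists y; rewrite yE; apply/seteqP; split=> z [].
  by move=> i _ <-; exists (g i) => //; apply/gP; exists i.
by move=> a /gP[i ->] <-; exists i.
Qed.

Lemma small_sub (A B : set V) : A `<=` B -> small B -> small A.
Proof.
move=> AB [x xB]; have [I [g gP]] := V_small x.
have [y yE] := small_range (fun i : {i | A (g i)} => g (sval i)).
exists y; rewrite yE; apply/seteqP; split=> z.
  by move=> [[i Ai] _ <-].
move=> Az; have : elts x z by rewrite xB; apply: AB.
by move=> /gP[i zi]; subst z; exists (exist _ i Az).
Qed.

Lemma small_card_le (A : set V) (y : V) : A #<= y -> small A.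
Proof.
move=> /pcard_surjP[f fA].
by apply: small_sub fA _; apply: small_image.
Qed.

Lemma small_bigcup (x : V) (F : V -> set V) :
  (forall i, i ∈ x -> small (F i)) -> small (\bigcup_(i in elts x) F i).
Proof.
move=> sF; have [I [g gP]] := V_small x.
have /choice[h hP] : forall i : I, exists J (f : J -> V), F (g i) = range f.
  move=> i; have [|y yE] := sF (g i); first by apply/gP; exists i.
  have [J [f fP]] := V_small y; exists J, f; rewrite -yE.
  by apply/seteqP; split=> z; [move=> /fP[j ->]; exists j|move=> [j _ <-]; apply/fP; exists j].
have [f fP] : exists f : forall i, h i -> V, forall i, F (g i) = range (f i).
  by exists (fun i => sval (cid (hP i))) => i; case: cid.
have [y yE] := small_range (fun p : {i & h i} => f (projT1 p) (projT2 p)).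
exists y; rewrite yE; apply/seteqP; split=> z.
  move=> [[i j] _ <-]; exists (g i); first by apply/gP; exists i.
  by rewrite fP; exists j.
move=> [a /gP[i ->]]; rewrite fP => -[j _ <-].
by exists (existT _ i j).
Qed.

Lemma small_powerset (x : V) : small [set y : V | y `<=` x].
Proof.
have [I [g gP]] := V_small x.
have [y yE] := small_range (fun P : I -> Prop => mkV (g @` P)).
exists y; rewrite yE; apply/seteqP; split=> z.
  move=> [P _ <-]; rewrite /= mkVE; last first.
    by apply: (small_sub _ (small_range g)) => u [i _ <-]; exists i.
  by move=> u [i _ <-]; apply/gP; exists i.
move=> /= zx; exists [set i | g i ∈ z] => //.
have zE : g @` [set i | g i ∈ z] = z.
  apply/seteqP; split=> u; first by move=> [i iz <-].
  by move=> uz; have /gP[i ui] := zx _ uz; exists i => //=; rewrite -ui.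
by rewrite zE mkV_elts.
Qed.

Lemma small_setU (A B : set V) : small A -> small B -> small (A `|` B).
Proof.
move=> [x <-] [y <-]; have [p pE] := small_range (fun b : bool => if b then x else y).
have -> : x `|` y = \bigcup_(i in elts p) elts i.
  rewrite pE; apply/seteqP; split=> z.
    by case=> ?; [exists x => //; exists true|exists y => //; exists false].
  by move=> [_ [[] _ <-]] ?; [left|right].
by apply: small_bigcup => i _; apply: small_elts.
Qed.

Lemma small_set1 (x : V) : small [set x].
Proof.
have [p pE] := small_range (fun _ : unit => x); exists p; rewrite pE.
by apply/seteqP; split=> z; [case=> _ _ <-|move=> ->; exists tt].
Qed.

(** * Ordinals *)

Lemma mem_irrefl (x : V) : ~ x ∈ x.
Proof. by elim: (mem_wf x) => {}x _ IH xx; apply: IH (xx). Qed.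

Lemma mem_asym (x y : V) : x ∈ y -> ~ y ∈ x.
Proof.
elim: (mem_wf x) y => {}x _ IH y xy yx; exact: (IH y yx x yx xy).
Qed.

Lemma ord_trans (a x y : V) : is_ordinal a -> x ∈ y -> y ∈ a -> x ∈ a.
Proof. by move=> [tr _] xy ya; apply: (tr _ ya). Qed.

Lemma ord_mem (a x : V) : is_ordinal a -> x ∈ a -> is_ordinal x.
Proof.
move=> oa xa; have [tr [tra tot]] := oa.
have xsub y : y ∈ x -> y ∈ a by move=> yx; apply: ord_trans yx xa.
split; last split.
- move=> y yx z zy; have ya := xsub _ yx.
  by apply: (tra z y x) => //; apply: ord_trans zy ya.
- by move=> u v w /xsub ux /xsub vx /xsub wx; apply: tra.
- by move=> u v /xsub ux /xsub vx; apply: tot.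
Qed.

Lemma ord_total (a b : V) : is_ordinal a -> is_ordinal b ->
  a ∈ b \/ a = b \/ b ∈ a.
Proof.
elim: (mem_wf a) b => {}a _ IHa b; elim: (mem_wf b) => {}b _ IHb oa ob.
have [?|nab] := EM (a ∈ b); first by left.
have [?|nba] := EM (b ∈ a); [by right; right|right; left].
apply: V_ext => z; split=> [za|zb].
  have [//|[zb|bz]] := IHa z za b (ord_mem oa za) ob; first by subst z.
  by case: nba; apply: ord_trans bz za.
have [az|[za|//]] := IHb z zb oa (ord_mem ob zb); last by subst z.
by case: nab; apply: ord_trans az zb.
Qed.

Lemma ord_of_trans (A : V) :
  transitive_class A -> (forall x, x ∈ A -> is_ordinal x) -> is_ordinal A.
Proof.
move=> tA oA; split=> //; split=> [x y z xA yA zA xy yz|x y xA yA].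
  by apply: ord_trans xy yz; apply: oA.
by apply: ord_total; apply: oA.
Qed.

Lemma ord_subE (a b : V) : is_ordinal a -> is_ordinal b ->
  a `<=` b -> a ∈ b \/ a = b.
Proof.
move=> oa ob ab; have [|[|/ab /mem_irrefl//]] := ord_total oa ob; by [left|right].
Qed.

Lemma mem_sub (a b : V) : is_ordinal b -> a ∈ b -> a `<=` b.
Proof. by move=> ob ab x xa; apply: ord_trans xa ab. Qed.

Lemma ord_notin (a b : V) : is_ordinal a -> is_ordinal b ->
  ~ a ∈ b -> b `<=` a.
Proof.
move=> oa ob ab; have [//|[->//|]] := ord_total oa ob; exact: mem_sub.
Qed.

Lemma ord_sub_notin (a b : V) : b `<=` a -> ~ a ∈ b.
Proof. by move=> ba /ba /mem_irrefl. Qed.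

Lemma ord_le_lt (a b c : V) : is_ordinal a -> is_ordinal c ->
  a `<=` b -> b ∈ c -> a ∈ c.
Proof.
move=> oa oc ab bc; have [|->//] := ord_subE oa (ord_mem oc bc) ab.
by move=> /ord_trans; apply.
Qed.

Lemma leastP (P : set V) a : is_ordinal a -> P a ->
  [/\ is_ordinal (least P), P (least P)
    & forall b, is_ordinal b -> P b -> least P `<=` b].
Proof.
move=> oa Pa; rewrite /least; set Q := (X in get X).
have [oq [Pq q_min]] : Q (get Q).
  apply: getPex; elim: (mem_wf a) oa Pa => {}a _ IH oa Pa.
  have [[b [ba Pb]]|nP] := EM (exists b, b ∈ a /\ P b).
    by apply: (IH b ba _ Pb); apply: ord_mem ba.
  by exists a; split=> //; split=> // x xa Px; apply: nP; exists x.
split=> // b ob Pb; apply: ord_notin => // bq; exact: q_min bq Pb.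
Qed.

Definition osucc (a : V) : V := mkV (a `|` [set a]).

Lemma osuccP a x : x ∈ osucc a <-> x ∈ a \/ x = a.
Proof.
rewrite /osucc mkVP //; exact: small_setU (small_elts a) (small_set1 a).
Qed.

Lemma mem_osucc a : a ∈ osucc a. Proof. by apply/osuccP; right. Qed.

Lemma osucc_ord a : is_ordinal a -> is_ordinal (osucc a).
Proof.
move=> oa; apply: ord_of_trans => [y /osuccP[ya|->] z zy|x /osuccP[xa|->//]].
- by apply/osuccP; left; apply: ord_trans ya.
- by apply/osuccP; left.
- exact: ord_mem xa.
Qed.

Lemma osucc_sub a b : is_ordinal b -> a ∈ b -> osucc a `<=` b.
Proof. by move=> ob ab x /osuccP[xa|->//]; apply: ord_trans ab. Qed.

Lemma osucc_inj a b : osucc a = osucc b -> a = b.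
Proof.
move=> ab; have : a ∈ osucc b by rewrite -ab; exact: mem_osucc.
have : b ∈ osucc a by rewrite ab; exact: mem_osucc.
by move=> /osuccP[|//] ba /osuccP[/mem_asym|].
Qed.

Lemma limit_osucc a b : is_limit a -> b ∈ a -> osucc b ∈ a.
Proof.
move=> [oa [_ la]] ba; have [c [ca bc]] := la _ ba.
have oc := ord_mem oa ca.
by apply: ord_le_lt (osucc_sub oc bc) ca => //; apply: osucc_ord (ord_mem oc bc).
Qed.

Lemma limit_max a b c : is_limit a -> b ∈ a -> c ∈ a ->
  exists d, [/\ d ∈ a, b ∈ d & c ∈ d].
Proof.
move=> la ba ca; have [oa _] := la.
have [bc|[bc|cb]] := ord_total (ord_mem oa ba) (ord_mem oa ca).
- by exists (osucc c); split; [exact: limit_osucc|apply/osuccP; left|exact: mem_osucc].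
- by exists (osucc c); split; [exact: limit_osucc|apply/osuccP; right|exact: mem_osucc].
- by exists (osucc b); split; [exact: limit_osucc|exact: mem_osucc|apply/osuccP; left].
Qed.

Lemma sup_ord (A : set V) : small A -> (forall x, A x -> is_ordinal x) ->
  exists s : V, is_ordinal s /\ elts s = \bigcup_(x in A) elts x.
Proof.
move=> [a aA] oA; have sm : small (\bigcup_(x in elts a) elts x).
  by apply: small_bigcup => i _; apply: small_elts.
have sE z := mkVP z sm.
exists (mkV (\bigcup_(x in A) elts x)); rewrite -aA mkVE //; split=> //.
apply: ord_of_trans => [y /sE[x xA yx] z zy|y /sE[x xA yx]].
  by apply/sE; exists x => //; apply: ord_trans yx => //; apply: oA; rewrite -aA.
by apply: ord_mem yx; apply: oA; rewrite -aA.
Qed.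

(** * Cardinality *)

Lemma inj_card_leP (T U : Type) (A : set T) (B : set U) (f : T -> U) :
  (forall x, A x -> B (f x)) ->
  (forall x y, A x -> A y -> f x = f y -> x = y) -> A #<= B.
Proof.
move=> AB fI; suff [g] : $|{injfun A >-> B}| by exact: inj_card_le.
by apply/injfunPex; exists f => // x y /set_mem Ax /set_mem Ay; apply: fI.
Qed.

Lemma card_le_inj (T : Type) (U : pointedType) (A : set T) (B : set U) :
  A #<= B -> exists f : T -> U,
    (forall x, A x -> B (f x)) /\
    (forall x y, A x -> A y -> f x = f y -> x = y).
Proof.
move=> /pcard_leP/injfunPex[f fB fI]; exists f; split=> // x y Ax Ay.
by apply: fI; apply: mem_set.
Qed.

Lemma cover_card_le (T U : Type) (A : set T) (B : set U) (f : U -> T) :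
  A `<=` f @` B -> A #<= B.
Proof. by move=> /subset_card_le/card_le_trans; apply; apply: card_image_le. Qed.

Lemma card_le_cover (T : pointedType) (U : Type) (A : set T) (B : set U) :
  A #<= B -> exists f : U -> T, A `<=` f @` B.
Proof. by move=> /pcard_surjP[f]; exists f. Qed.

Lemma card_le_setX (T U : Type) (W X : pointedType)
    (A : set T) (B : set U) (C : set W) (D : set X) :
  A #<= C -> B #<= D -> A `*` B #<= C `*` D.
Proof.
move=> /card_le_inj[f [fC fI]] /card_le_inj[g [gD gI]].
apply: (@inj_card_leP _ _ _ _ (fun p => (f p.1, g p.2))).
  by move=> [x y] [/= /fC ? /gD ?].
by move=> [x y] [x' y'] [/= Ax Ay] [/= Ax' Ay'] [/fI -> // /gI -> //].
Qed.

Lemma collapse (T : Type) (A : set T) (R : T -> T -> Prop) :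
  well_founded R ->
  (forall p q r, A p -> A q -> A r -> R p q -> R q r -> R p r) ->
  (forall p, A p -> exists y : V, [set q | A q /\ R q p] #<= y) ->
  exists G : T -> V,
    [/\ forall p, A p -> is_ordinal (G p),
        forall p q, A p -> A q -> R q p -> G q ∈ G p
      & forall p z, A p -> z ∈ G p -> exists q, [/\ A q, R q p & z = G q]].
Proof.
move=> wfR trR segR.
pose G := Fix wfR (fun=> V)
  (fun p rec => mkV [set z | exists q (h : R q p), A q /\ z = rec q h]).
have GE p z : A p -> z ∈ G p <-> exists q, [/\ A q, R q p & z = G q].
  move=> Ap; rewrite {1}/G Fix_eq; last first.
    by move=> q f g fg; congr mkV; congr mkset; apply/funext => u;
      apply/propext; split=> -[r [h [Ar ->]]]; exists r, h; rewrite fg.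
  rewrite mkVP; first by split=> [[q [h [Aq ->]]]|[q [Aq h ->]]]; [exists q|exists q, h].
  have [y segy] := segR _ Ap.
  apply: (@small_card_le _ y); apply: card_le_trans segy.
  apply: (@cover_card_le _ _ _ _ G) => u [q [h [Aq ->]]].
  by exists q.
exists G; split=> [p|p q Ap Aq Rqp|p z Ap /(GE _ _ Ap) //]; last by apply/GE => //; exists q.
elim: (wfR p) => {}p _ IH Ap; apply: ord_of_trans => [y|x].
  move=> /(GE _ _ Ap)[q [Aq qp ->]] z /(GE _ _ Aq)[r [Ar rq ->]].
  by apply/GE => //; exists r; split=> //; apply: trR rq qp.
by move=> /(GE _ _ Ap)[q [Aq qp ->]]; apply: IH.
Qed.

Lemma well_order_type (T : eqType) : exists R : T -> T -> Prop,
  [/\ well_founded R, forall x y z, R x y -> R y z -> R x z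
    & forall x y, R x y \/ x = y \/ R y x].
Proof.
have [S woS] := wochoice.well_ordering_principle T.
have minS (A : set T) : A !=set0 -> exists z, A z /\ forall x, A x -> S z x.
  move=> [a Aa]; have [|z [[zA zmin] _]] := woS (mem A).
    by exists a; apply: mem_set.
  by exists z; split; [exact: set_mem zA|move=> x Ax; apply: zmin; apply: mem_set].
have refS x : S x x by have [|z [-> ]] := minS [set x]; [exists x|exact].
have totS x y : S x y \/ S y x.
  have [|z [[] -> zm]] := minS [set x; y]; first by exists x; left.
    by left; apply: zm; right.
  by right; apply: zm; left.
have antS x y : S x y -> S y x -> x = y.
  move=> xy yx; have [|z [[_ _] zu]] := woS (mem [set x; y]).
    by exists x; apply: mem_set; left.
  rewrite -(zu x) ?(zu y) //; split; try by apply: mem_set; (left + right).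
    by move=> w /set_mem[] ->.
  by move=> w /set_mem[] ->.
have trS x y z : S x y -> S y z -> S x z.
  move=> xy yz; have [|w [[[]|] -> wm]] := minS [set x; y; z]; first by exists x; left; left.
  - by apply: wm; right.
  - by rewrite (antS _ _ xy (wm x _)) //; left; left.
  - by rewrite -(antS _ _ yz (wm y _)) //; left; right.
exists (fun x y => S x y /\ x <> y); split=> [x|x y z [xy nxy] [yz nyz]|x y].
- apply: contrapT => nx.
  have [|z [nz zm]] := minS [set x | ~ Acc (fun x y => S x y /\ x <> y) x].
    by exists x.
  apply: nz; constructor=> y [yz nyz]; apply: contrapT => ny; apply: nyz.
  exact: antS yz (zm _ ny).
- split; first exact: trS yz.
  by move=> xz; subst z; apply: nxy; apply: antS.
- have [->|xy] := EM (x = y); [by right; left|].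
  by have [|] := totS x y; [left|right; right; split=> // /esym].
Qed.

Lemma ord_card (x : V) : exists a : V, is_ordinal a /\ x #= a.
Proof.
have [R [wfR trR totR]] := well_order_type V.
have [|p xp|G [oG G1 G2]] := @collapse _ x _ wfR; first by move=> *; apply: trR; eassumption.
  by exists x; apply: subset_card_le => q [].
have sG := small_image G x; have GE y := mkVP y sG.
have G_inj p q : p ∈ x -> q ∈ x -> G p = G q -> p = q.
  move=> xp xq pq; have [/(G1 _ _ xq xp)|[//|/(G1 _ _ xp xq)]] := totR p q;
  by rewrite pq => /mem_irrefl.
exists (mkV (G @` x)); split.
  apply: ord_of_trans => [y /GE[p xp <-] z /(G2 _ _ xp)[q [xq _ ->]]|y /GE[p xp <-]].
    by apply/GE; exists q.
  exact: oG.
rewrite card_eq_sym mkVE //; apply: inj_card_eq => p q /set_mem xp /set_mem xq.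
exact: G_inj.
Qed.

Lemma infinite_card_le (T U : Type) (A : set T) (B : set U) :
  A #<= B -> infinite_set A -> infinite_set B.
Proof. by move=> AB iA fB; apply: iA; apply: card_le_finite AB fB. Qed.

Lemma countable_card_le (T U : Type) (A : set T) (B : set U) :
  countable A -> infinite_set B -> A #<= B.
Proof. by move=> cA /infiniteP; apply: card_le_trans. Qed.

Lemma infinite_two (T : Type) (A : set T) : infinite_set A ->
  exists x y, [/\ A x, A y & x <> y].
Proof.
move=> iA; have [x Ax] := infinite_setN0 iA.
apply: contrapT => nxy; apply: iA; apply: (sub_finite_set _ (finite_set1 x)).
move=> y Ay; apply: contrapT => xy; apply: nxy; exists x, y; split=> //.
by move=> yx; apply: xy.
Qed.

Lemma osucc_card_le (m : V) : infinite_set m -> m `*` m #<= m -> osucc m #<= m.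
Proof.
move=> im; apply: card_le_trans; have [u [v [um vm uv]]] := infinite_two im.
apply: (@inj_card_leP _ _ _ _ (fun x => if x == m then (u, v) else (x, u))).
  by move=> x /osuccP[xm|->]; [case: eqVneq|rewrite eqxx].
move=> x y _ _; case: eqVneq => [->|_]; case: eqVneq => [->|_] // [].
- by move=> _ /esym /uv.
- by move=> _ /uv.
- by [].
Qed.

Lemma finite_osucc (m : V) : finite_set m -> finite_set (osucc m).
Proof.
move=> fm; rewrite mkVE; first by rewrite finite_setU; split.
exact: small_setU (small_elts _) (small_set1 _).
Qed.

(* [mx] is the maximum of a pair of ordinals. *)
Definition godel (q p : V * V) : Prop :=
  let mx (p : V * V) := if `[< p.1 ∈ p.2 >] then p.2 else p.1 in
  mx q ∈ mx p \/ mx q = mx p /\ (q.1 ∈ p.1 \/ q.1 = p.1 /\ q.2 ∈ p.2).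

Lemma godel_wf : well_founded godel.
Proof.
move=> p; move: {2}(if _ then _ else _) (erefl (if `[< p.1 ∈ p.2 >] then p.2 else p.1)) => m.
elim: (mem_wf m) p => {}m _ IHm [x y]; elim: (mem_wf x) y => {}x _ IHx y.
elim: (mem_wf y) => {}y _ IHy /= pm; constructor=> -[u v] [].
  by rewrite /= pm => /IHm; apply.
move=> [/= + []]; rewrite pm => um; first by move=> /IHx; apply.
by move=> -[ux vy]; subst u; apply: IHy.
Qed.

Lemma card_le_sqr (a : V) : is_ordinal a -> infinite_set a -> a `*` a #<= a.
Proof.
elim: (mem_wf a) => {}a _ IH oa ia.
have [[b [ba ab]]|acard] := EM (exists b, b ∈ a /\ a #<= b).
  have bb : b `*` b #<= b.
    by apply: IH => //; [exact: ord_mem ba|exact: infinite_card_le ia].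
  apply: card_le_trans (card_le_setX ab ab) (card_le_trans bb _).
  by apply: subset_card_le; apply: mem_sub.
have sub_lt c : is_ordinal c -> a #<= c `*` c -> a `<=` c.
  move=> oc acc; apply: ord_notin => // ca; apply: acard; exists c; split=> //.
  have [fc|ic] := EM (finite_set c).
    by case: ia; apply: card_le_finite acc _; apply: finite_setX.
  by apply: card_le_trans acc _; apply: IH.
have succ_lt m : m ∈ a -> osucc m ∈ a.
  move=> ma; have om := ord_mem oa ma; have os := osucc_ord om.
  apply: contrapT => /(ord_notin os oa)/subset_card_le am.
  have im : infinite_set m.
    by move=> /finite_osucc fm; apply: ia; apply: card_le_finite am fm.
  apply: acard; exists m; split=> //; apply: card_le_trans am _.
  by apply: osucc_card_le => //; apply: IH.
pose mx (p : V * V) := if `[< p.1 ∈ p.2 >] then p.2 else p.1.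
have mxP p : p.1 ∈ a -> p.2 ∈ a -> [/\ mx p ∈ a, p.1 `<=` mx p & p.2 `<=` mx p].
  rewrite /mx => pa qa; have [op oq] := (ord_mem oa pa, ord_mem oa qa).
  by case: asboolP => [|/ord_notin] h; split=> //; [apply: mem_sub|apply: h].
have segS p : p.1 ∈ a -> p.2 ∈ a ->
    [set q | (a `*` a) q /\ godel q p] `<=` osucc (mx p) `*` osucc (mx p).
  move=> p1 p2 q [[/= q1 q2]]; rewrite /godel -!/(mx _) => qp.
  have [mp _ _] := mxP _ p1 p2; have [mq q1m q2m] := mxP _ q1 q2.
  have qps : mx q `<=` mx p by case: qp => [/mem_sub|[-> _] //]; apply; apply: ord_mem mp.
  have os := osucc_ord (ord_mem oa mp).
  by split; apply: (ord_le_lt _ os (subset_trans _ qps) (mem_osucc _)) => //; apply: ord_mem oa _.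
have [||G [oG G1 G2]] := @collapse _ (a `*` a) _ godel_wf.
- move=> p q r [/= p1 p2] [/= q1 q2] [/= r1 r2].
  have [mp _ _] := mxP _ p1 p2; have [mq _ _] := mxP _ q1 q2; have [mr _ _] := mxP _ r1 r2.
  rewrite /godel -!/(mx _) => -[pq|[pq pq']].
    move=> [qr|[<- _]]; [left|by left].
    exact: (ord_trans (ord_mem oa mr) pq).
  rewrite pq => -[|[<- qr']]; [by left|right; split=> //].
  case: pq' => [pq1|[-> pq2]]; case: qr' => [qr1|[<- qr2]].
  + by left; apply: (ord_trans (ord_mem oa r1) pq1).
  + by left.
  + by left.
  + by right; split=> //; apply: (ord_trans (ord_mem oa r2) pq2).
- move=> p [p1 p2]; exists a; apply: card_le_trans (subset_card_le (segS p p1 p2)) _.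
  have [/succ_lt ma _ _] := mxP _ p1 p2.
  have [fc|ic] := EM (finite_set (osucc (mx p))).
    by apply: countable_card_le ia; apply/finite_set_countable/finite_setX.
  apply: card_le_trans (IH _ ma (ord_mem oa ma) ic) _.
  by apply: subset_card_le; apply: mem_sub.
apply: (@inj_card_leP _ _ _ _ G) => [p ap|p q ap aq pq].
  apply: contrapT => /(ord_notin (oG _ ap) oa)/subset_card_le aG.
  have [p1 p2] := ap; have [/succ_lt ma _ _] := mxP _ p1 p2.
  have : a #<= osucc (mx p) `*` osucc (mx p).
    apply: card_le_trans aG (card_le_trans _ (subset_card_le (segS p p1 p2))).
    by apply: (@cover_card_le _ _ _ _ G) => z /(G2 _ _ ap)[q [aq qp ->]]; exists q.
  by move=> /(sub_lt _ (ord_mem oa ma))/(_ _ ma)/mem_irrefl.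
have Gne r s : (a `*` a) r -> (a `*` a) s -> godel r s -> G r <> G s.
  by move=> ar as_ /(G1 _ _ as_ ar) + rs; rewrite rs; apply: mem_irrefl.
have [|[//|]] : godel p q \/ p = q \/ godel q p; last first.
- by move=> /(Gne _ _ aq ap); rewrite pq.
- by move=> /(Gne _ _ ap aq); rewrite pq.
rewrite /godel -!/(mx _); have [[p1 p2] [q1 q2]] := (ap, aq).
have [mp _ _] := mxP _ p1 p2; have [mq _ _] := mxP _ q1 q2.
have tot := fun x y (xa : x ∈ a) (ya : y ∈ a) => ord_total (ord_mem oa xa) (ord_mem oa ya).
have [|[mpq|]] := tot _ _ mp mq; [by left; left| |by right; right; left].
have [|[pq1|]] := tot _ _ p1 q1; [by left; right; split=> //; left| |].
  have [|[pq2|]] := tot _ _ p2 q2; [by left; right; split=> //; right| |].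
    by right; left; move: pq1 pq2; case: (p); case: (q) => ? ? ? ? /= -> ->.
  by right; right; right; split=> //; right.
by right; right; right; split=> //; left.
Qed.

Section InfiniteOrdinal.
Variable a : V.
Hypotheses (oa : is_ordinal a) (ia : infinite_set a).

Lemma card_le_binary (T U W : Type) (h : T -> U -> W)
    (X : set T) (Y : set U) (A : set W) :
  (forall w, A w -> exists x y, [/\ X x, Y y & w = h x y]) ->
  X #<= a -> Y #<= a -> A #<= a.
Proof.
move=> hA Xa Ya; apply: card_le_trans (card_le_sqr oa ia).
apply: card_le_trans (card_le_setX Xa Ya).
apply: (@cover_card_le _ _ _ _ (fun p => h p.1 p.2)) => w /hA[x [y [Xx Yy ->]]].
by exists (x, y).
Qed.

Lemma card_le_bigcup (T U : Type) (I : set T) (F : T -> set U) :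
  I #<= a -> (forall i, I i -> F i #<= a) -> \bigcup_(i in I) F i #<= a.
Proof.
elim/Ppointed: U => U in F *; first by rewrite !emptyE.
move=> Ia Fa; have /choice[f fP] : forall i, exists g : V -> U, I i -> F i `<=` g @` a.
  move=> i; have [/Fa/card_le_cover[g]|] := EM (I i); first by exists g.
  by exists (fun=> point).
apply: (card_le_binary (h := f) (X := I) (Y := a)) => // w [i Ii].
by move=> /(fP _ Ii)[v av <-]; exists i, v.
Qed.

Lemma card_le_setU (T : Type) (A B : set T) :
  A #<= a -> B #<= a -> A `|` B #<= a.
Proof.
move=> Aa Ba.
have -> : A `|` B = \bigcup_(b in [set: bool]) (if b then A else B).
  apply/seteqP; split=> x; first by case=> ?; [exists true|exists false].
  by case=> -[] _ ?; [left|right].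
apply: card_le_bigcup => [|[]//].
by apply: countable_card_le => //; apply: countableP.
Qed.

Lemma card_le_seq (A : set V) :
  A #<= a -> [set s : seq V | forall x, x \in s -> A x] #<= a.
Proof.
move=> Aa; set S := (X in X #<= _).
have Sn n : S `&` [set s | size s = n] #<= a.
  elim: n => [|n IH].
    apply: countable_card_le => //; apply: sub_countable (countable1 [::]).
    by apply: subset_card_le => s [_ /= /size0nil].
  apply: (card_le_binary (h := cons) _ Aa IH); case=> [|x s] [sA] //= [sn].
  exists x, s; split=> //; first by apply: sA; rewrite mem_head.
  by split=> // y ys; apply: sA; rewrite inE ys orbT.
apply: card_le_trans (_ : \bigcup_(n in [set: nat]) (S `&` [set s | size s = n]) #<= a).
  by apply: subset_card_le => s Ss; exists (size s).
by apply: card_le_bigcup => //; apply: countable_card_le.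
Qed.

End InfiniteOrdinal.

Lemma cardinal_ord (k : V) : cardinal k -> is_ordinal k. Proof. by case. Qed.

Lemma card_ltP (k : V) (A : set V) : cardinal k ->
  (card_lt A k <-> exists l : V, l ∈ k /\ A #<= l).
Proof.
move=> [ok ck]; split=> [[Ak kA]|[l [lk Al]]].
  have [x xA] := small_card_le Ak; have [l [ol xl]] := ord_card x.
  move: xl; rewrite xA => /card_eqPle[Al lA]; exists l; split=> //.
  apply: contrapT => /(ord_notin ol ok)/subset_card_le kl; apply: kA.
  exact: card_le_trans kl lA.
have [lk1 lk2] := ck _ lk; split; first exact: card_le_trans Al lk1.
by move=> kA; apply: lk2; apply: card_le_trans kA Al.
Qed.

Lemma card_lt_le (A B : set V) (k : V) : cardinal k ->
  A #<= B -> card_lt B k -> card_lt A k.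
Proof.
move=> ck AB /(card_ltP _ ck)[l [lk Bl]]; apply/card_ltP => //.
by exists l; split=> //; apply: card_le_trans Bl.
Qed.

Lemma card_lt_small (A : set V) (k : V) : card_lt A k -> small A.
Proof. by case=> /small_card_le. Qed.

Lemma cantor (x : V) : ~ ([set y : V | y `<=` x] #<= x).
Proof.
move=> /card_le_cover[f fP].
have sD : small [set z | z ∈ x /\ ~ z ∈ f z].
  by apply: small_sub (small_elts x) => z [].
have [|z zx fz] := fP (mkV [set z | z ∈ x /\ ~ z ∈ f z]).
  by move=> z /(mkVP _ sD)[].
have : z ∈ f z <-> z ∈ x /\ ~ z ∈ f z by rewrite {1}fz; apply: mkVP.
by tauto.
Qed.

Section SuccCardinal.
Variable m : V.
Hypothesis om : is_ordinal m.

Let succ_ex : exists n, cardinal n /\ m ∈ n.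
Proof.
have [p pE] := small_powerset m; have [b [ob /card_eqPle[pb _]]] := ord_card p.
have [|on nm nmin] := @leastP [set c : V | ~ (c #<= m)] b ob.
  by move=> /(card_le_trans pb); rewrite pE; apply: cantor.
exists (least [set c : V | ~ (c #<= m)]); split.
  have le c : c ∈ least [set c : V | ~ (c #<= m)] -> c #<= m.
    move=> cl; apply: contrapT => /(nmin _ (ord_mem on cl)) lc.
    exact: ord_sub_notin lc cl.
  split=> // c cl; split; first by apply: subset_card_le; apply: mem_sub.
  by move=> lc; apply: nm; apply: card_le_trans lc (le _ cl).
by apply: contrapT => /(ord_notin om on)/subset_card_le.
Qed.

Lemma succ_cardinalP :
  [/\ cardinal (succ_cardinal m), m ∈ succ_cardinal m
    & forall n, cardinal n -> m ∈ n -> succ_cardinal m `<=` n].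
Proof.
have [n [cn mn]] := succ_ex.
have [_ [? ?] lmin] := @leastP [set n | cardinal n /\ m ∈ n] n (cardinal_ord cn) (conj cn mn).
by split=> // k ck mk; apply: lmin => //; apply: cardinal_ord.
Qed.

Lemma mem_succ_cardinal x : x ∈ succ_cardinal m <-> is_ordinal x /\ x #<= m.
Proof.
have [cs ms smin] := succ_cardinalP; have [os cs'] := cs.
split=> [xs|[ox xm]]; last first.
  apply: contrapT => /(ord_notin ox os)/subset_card_le sx.
  by have [_ []] := cs' _ ms; apply: card_le_trans sx xm.
split; first exact: ord_mem xs.
have ox := ord_mem os xs.
have [ok xk kmin] := @leastP [set l : V | x #<= l] x ox (card_lexx _).
apply: (card_le_trans xk); apply: subset_card_le; apply: ord_notin => // mk.
apply: (@ord_sub_notin x (succ_cardinal m)) xs.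
apply: subset_trans (kmin _ ox (card_lexx _)); apply: smin => //.
split=> // z zk; split; first by apply: subset_card_le; apply: mem_sub.
move=> kz; apply: (ord_sub_notin (kmin _ (ord_mem ok zk) _) zk).
exact: card_le_trans xk kz.
Qed.
End SuccCardinal.

(** * Cofinality *)

Lemma cardinal_limit (k : V) : cardinal k -> infinite_set k -> is_limit k.
Proof.
move=> [ok ck] ik; split=> //; split; first exact: infinite_setN0 ik.
move=> m mk; exists (osucc m); split; last exact: mem_osucc.
have om := ord_mem ok mk; apply: contrapT => /(ord_notin (osucc_ord om) ok)/subset_card_le km.
have im : infinite_set m by move=> /finite_osucc fm; apply: ik; apply: card_le_finite km fm.
have [_ []] := ck _ mk; apply: card_le_trans km (osucc_card_le im _).
exact: card_le_sqr.
Qed.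

Lemma cofP (a : V) : is_ordinal a ->
  [/\ is_ordinal (cof a),
      exists f : V -> V, (forall i, i ∈ cof a -> f i ∈ a) /\ unbounded_in (f @` cof a) a
    & forall c f, is_ordinal c -> (forall i, i ∈ c -> f i ∈ a) ->
        unbounded_in (f @` c) a -> cof a `<=` c].
Proof.
move=> oa; pose P : set V := [set c | is_ordinal c /\ exists f : V -> V,
                   (forall i, i ∈ c -> f i ∈ a) /\ unbounded_in (f @` c) a].
have Pa : P a.
  by split=> //; exists id; split=> // x xa; exists x; split; [exists x|split].
have [oc [_ cf] cmin] := @leastP P a oa Pa.
by split=> // c f oc' fa fu; apply: cmin => //; split=> //; exists f.
Qed.

Lemma cof_bounded (a l : V) (A : set V) : is_ordinal a -> l ∈ cof a ->
  A `<=` a -> A #<= l -> exists2 b, b ∈ a & forall x, A x -> x ∈ b.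
Proof.
move=> oa lc Aa Al; have [oc [f [fa _]] cmin] := cofP oa.
have [[x0 Ax0]|A0] := EM (A !=set0); last first.
  by exists (f l); [exact: fa|move=> x Ax; case: A0; exists x].
apply: contrapT => nb; apply: (@ord_sub_notin l (cof a)) (lc).
have [g gP] := card_le_cover Al.
apply: (cmin _ (fun i => if `[< A (g i) >] then g i else x0)).
- exact: ord_mem lc.
- by move=> i _; case: asboolP => ?; apply: Aa.
move=> x xa; apply: contrapT => nx; apply: nb; exists x => // y Ay.
have [oy ox] := (ord_mem oa (Aa _ Ay), ord_mem oa xa).
apply: contrapT => yx; apply: nx; exists y; split; last split; first last.
- exact: ord_notin.
- exact: Aa.
have [i il giy] := gP _ Ay; exists i => //.
by rewrite giy; case: asboolP.
Qed.

Lemma cof_card_lt_bounded (a k : V) (A : set V) : is_ordinal a -> cardinal k ->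
  k `<=` cof a -> A `<=` a -> card_lt A k ->
  exists2 b, b ∈ a & forall x, A x -> x ∈ b.
Proof.
by move=> oa ck ka Aa /(card_ltP _ ck)[l [/ka lk Al]]; apply: cof_bounded lk Aa Al.
Qed.

Lemma card_lt_finite (A : set V) (k : V) : cardinal k -> infinite_set k ->
  finite_set A -> card_lt A k.
Proof.
move=> ck ik fA; split; first by apply: countable_card_le => //; apply: finite_set_countable.
by move=> kA; apply: ik; apply: card_le_finite kA fA.
Qed.

Lemma cof_limit (a k : V) : is_ordinal a -> cardinal k -> infinite_set k ->
  k `<=` cof a -> is_limit a.
Proof.
move=> oa ck ik ka; split=> //.
have bd (A : set V) : finite_set A -> A `<=` a -> exists2 b, b ∈ a & forall x, A x -> x ∈ b.
  by move=> fA Aa; apply: cof_card_lt_bounded ka Aa _ => //; apply: card_lt_finite.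
split; first by have [b ba _] := bd set0 (finite_set0 _) (@sub0set _ _); exists b.
move=> x xa; have [|b ba xb] := bd [set x] (finite_set1 _); first by move=> _ ->.
by exists b; split=> //; apply: xb.
Qed.

Lemma limit_inf (a : V) : is_limit a -> infinite_set a.
Proof.
move=> la; have [oa [[x xa] _]] := la.
have fa n : iter n osucc x ∈ a by elim: n => [|n] //; exact: limit_osucc.
have lt n k : iter n osucc x ∈ iter (n + k).+1 osucc x.
  elim: k => [|k IH]; first by rewrite addn0; apply: mem_osucc.
  by rewrite addnS; apply/osuccP; left.
have lt' n k : (n < k)%N -> iter n osucc x ∈ iter k osucc x.
  by move=> nk; rewrite -(subnKC nk) addSn.
apply/infiniteP; apply: (@inj_card_leP _ _ _ _ (fun n => iter n osucc x)) => [n _|n k _ _ nk]; first exact: fa.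
by case: (ltngtP n k) => // /lt'; rewrite nk => /mem_irrefl.
Qed.

Lemma limit_cof (a : V) : is_limit a -> is_limit (cof a).
Proof.
move=> la; have [oa [a0 al]] := la; have [oc [f [fa fu]] cmin] := cofP oa.
split=> //; split.
  by have [x xa] := a0; have [_ [[i ic _] _]] := fu _ xa; exists i.
move=> i ic; apply: contrapT => nj.
have ci j : j ∈ cof a -> j ∈ i \/ j = i.
  move=> jc; have [|[]] := ord_total (ord_mem oc jc) (ord_mem oc ic); [by left|by right|].
  by move=> ij; case: nj; exists j.
have [||b ba fb] := cof_bounded (A := f @` i) oa ic.
- by move=> _ [j ji <-]; apply: fa; apply: ord_trans ji ic.
- exact: card_image_le.
have [d [da bd fd]] := limit_max la ba (fa _ ic).
have [_ [[j jc <-] [fja dfj]]] := fu _ da.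
case: (ci _ jc) => [ji|ji]; last by subst j; apply: mem_irrefl (dfj _ fd).
have fjb : f j ∈ b by apply: fb; exists j.
by apply: mem_irrefl (dfj _ _); apply: ord_trans fjb bd; apply: ord_mem da.
Qed.

Lemma card_lt_bigcup (k t : V) (I : set V) (F : V -> set V) :
  regular k -> t ∈ k -> infinite_set t ->
  card_lt I k -> (forall i, I i -> card_lt (F i) k) ->
  card_lt (\bigcup_(i in I) F i) k.
Proof.
move=> [ck [ik kk]] tk it /(card_ltP _ ck)[l [lk Il]] Fk.
have ok := cardinal_ord ck; have lim := cardinal_limit ck ik.
have /choice[g gP] : forall i, exists z, I i -> z ∈ k /\ F i #<= z.
  move=> i; have [/Fk/(card_ltP _ ck)[z zP]|] := EM (I i); first by exists z.
  by exists l.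
have [|||b bk gb] := @cof_bounded k l (g @` I) ok.
- by rewrite kk.
- by move=> _ [i /gP[]] + _ <-.
- exact: card_le_trans (card_image_le _ _) Il.
have [c [ck' lc bc]] := limit_max lim lk bk.
have [d [dk cd td]] := limit_max lim ck' tk.
have od := ord_mem ok dk; have sd := fun x xd => subset_card_le (mem_sub od (a := x) xd).
apply/card_ltP => //; exists d; split=> //; apply: card_le_bigcup => //.
- exact: infinite_card_le (sd _ td) it.
- apply: card_le_trans Il (sd _ _); exact: ord_trans lc cd.
move=> i Ii; have [_ Fg] := gP _ Ii; apply: card_le_trans Fg (sd _ _).
apply: (ord_trans od _ cd); apply: ord_trans bc; first exact: ord_mem cd.
by apply: gb; exists i.
Qed.

Section SuccRegular.
Variable m : V.
Hypotheses (om : is_ordinal m) (im : infinite_set m).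
Let P := succ_cardinal m.

Lemma succ_cardinal_inf : infinite_set P.
Proof.
have [cP mP _] := succ_cardinalP om.
apply: infinite_card_le im; apply: subset_card_le.
exact: mem_sub (cardinal_ord cP) mP.
Qed.

Lemma succ_cardinal_bounded (A : set V) : A `<=` P -> A #<= m ->
  exists2 b, b ∈ P & forall x, A x -> x ∈ b.
Proof.
move=> AP Am; have [cP _ _] := succ_cardinalP om; have oP := cardinal_ord cP.
have oA x : A x -> is_ordinal x by move=> /AP; apply: ord_mem.
have [s [os sE]] := sup_ord (small_card_le Am) oA.
have sP : s ∈ P.
  apply/mem_succ_cardinal => //; split=> //; rewrite sE.
  by apply: card_le_bigcup => // x /AP/(mem_succ_cardinal om)[].
exists (osucc s); first exact: limit_osucc (cardinal_limit cP succ_cardinal_inf) sP.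
move=> x Ax; apply: ord_le_lt (oA _ Ax) (osucc_ord os) _ (mem_osucc s).
by rewrite sE => y yx; exists x.
Qed.

Lemma succ_cardinal_regular : regular P.
Proof.
have [cP mP _] := succ_cardinalP om; have oP := cardinal_ord cP.
split=> //; split; first exact: succ_cardinal_inf.
have [oc [f [fP fu]] cmin] := cofP oP.
have : cof P `<=` P by apply: (cmin _ id) => // x xP; exists x; split; [exists x|split].
move=> /(ord_subE oc oP)[cP'|//].
have [|_ cm] := (mem_succ_cardinal om (cof P)).1 _ => //.
have [||b bP fb] := @succ_cardinal_bounded (f @` cof P).
- by move=> _ [i ic <-]; apply: fP.
- exact: card_le_trans (card_image_le _ _) cm.
by have [y [/fb yb [_ /(_ _ yb) /mem_irrefl]]] := fu _ bP.
Qed.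
End SuccRegular.

Lemma mem_rec (G : V -> (V -> V) -> V) : exists f : V -> V,
  forall x, f x = G x (fun y => if `[< y ∈ x >] then f y else emptyV).
Proof.
exists (Fix mem_wf (fun=> V) (fun x rec => G x (fun y =>
  match pselect (y ∈ x) with left yx => rec y yx | right _ => emptyV end))) => x.
rewrite Fix_eq => [|y f g fg]; congr (G _ _); apply/funext => z.
  by rewrite /asbool; case: pselect.
by case: pselect.
Qed.

(** * Closed unbounded sets *)

Section Club.
Variable m : V.
Hypotheses (om : is_ordinal m) (im : infinite_set m).
Let P := succ_cardinal m.
Let cP : cardinal P. Proof. by have [] := succ_cardinalP om. Qed.
Let oP : is_ordinal P. Proof. exact: cardinal_ord. Qed.
Lemma club_enum (D : set V) : club D P -> exists d : V -> V,
  [/\ forall a, a ∈ P -> D (d a),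
      forall a b, b ∈ P -> a ∈ b -> d a ∈ d b
    & forall a, a ∈ P -> is_limit a ->
        is_limit (d a) /\ forall z, z ∈ d a -> exists2 b, b ∈ a & z ∈ d b].
Proof.
move=> [DP [Du Dc]].
have [d dE] := mem_rec (fun a r => least [set e | D e /\ forall b, b ∈ a -> r b ∈ e]).
have {}dE a : d a = least [set e | D e /\ forall b, b ∈ a -> d b ∈ e].
  rewrite {1}dE; congr least; apply/seteqP; split=> e [De eb]; split=> // b ba.
    by have := eb b ba; case: asboolP.
  by case: asboolP => // _; apply: eb.
have dP a : a ∈ P -> [/\ D (d a), forall b, b ∈ a -> d b ∈ d a
    & forall e, D e -> (forall b, b ∈ a -> d b ∈ e) -> d a `<=` e].
  elim: (mem_wf a) => {}a _ IH aP.
  have [||b bP db] := @succ_cardinal_bounded m om im (d @` a).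
  - move=> _ [b ba <-]; apply: DP.
    by have [] := IH b ba (ord_trans oP ba aP).
  - apply: card_le_trans (card_image_le _ _) _.
    by have [] := (mem_succ_cardinal om a).1 aP.
  have [e [De [eP be]]] := Du _ bP.
  have [|_ [De' eb] emin] := @leastP [set e | D e /\ forall b, b ∈ a -> d b ∈ e] e (ord_mem oP eP).
    by split=> // c ca; apply: be; apply: db; exists c.
  rewrite -dE in De' eb emin; split=> // f Df fb; apply: emin => //.
  by apply: ord_mem oP _; apply: DP.
have dm a b : b ∈ P -> a ∈ b -> d a ∈ d b.
  by move=> bP ab; have [_ + _] := dP _ bP; apply.
exists d; split=> // [a /dP[]//|a aP la].
have [oa [ane la']] := la.
have Pd b : b ∈ a -> d b ∈ P.
  by move=> ba; apply: DP; have [] := dP _ (ord_trans oP ba aP).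
have [|x [c ca <-]|s [os sE]] := @sup_ord (d @` a).
- exact: small_image.
- exact: ord_mem oP (Pd _ ca).
have sP z : z ∈ s <-> exists2 b, b ∈ a & z ∈ d b.
  rewrite -[z ∈ s]/(elts s z) sE; split; first by move=> [_ [b ba <-] ?]; exists b.
  by move=> [b ba zb]; exists (d b) => //; exists b.
have ds b : b ∈ a -> d b ∈ s.
  move=> /la'[c [ca bc]]; apply/sP; exists c => //.
  by apply: dm => //; apply: ord_trans ca aP.
have ls : is_limit s.
  split=> //; split; first by have [b /ds] := ane; exists (d b).
  by move=> x /sP[b ba xb]; exists (d b); split=> //; apply: ds.
have [Dda dba damin] := dP _ aP.
have sda : s `<=` d a by move=> z /sP[b ba]; apply: (mem_sub (ord_mem oP (DP _ Dda)) (dba _ ba)).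
have sP' : s ∈ P by apply: ord_le_lt os oP sda _; apply: DP.
suff -> : d a = s by split=> // z /sP.
apply: elts_inj; apply/seteqP; split=> //; apply: damin => //.
apply: Dc => // x /sP[b ba xb]; exists (d b); split; last split.
- by split; [have [] := dP _ (ord_trans oP ba aP)|apply: ds].
- exact: ds.
- exact: mem_sub (ord_mem oP (Pd _ ba)) xb.
Qed.

Lemma club_closed (h : V -> V) : (forall a, a ∈ P -> h a ∈ P) ->
  club [set a | [/\ a ∈ P, is_limit a & forall b, b ∈ a -> h b ∈ a]] P.
Proof.
move=> hP; split; first by move=> a [].
split=> [x xP|a aP la au]; last first.
  split=> // b ba; have sba := limit_osucc la ba.
  have [y [[[_ _ hy] _] [ya by']]] := au _ sba.
  apply: ord_trans ya; first by case: la.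
  by apply: hy; apply: by'; apply: mem_osucc.
have /choice[s sP] : forall a, exists b, a ∈ P ->
    [/\ b ∈ P, a ∈ b & forall c, c ∈ a -> h c ∈ b].
  move=> a; have [aP|] := EM (a ∈ P); last by exists a.
  have [||b bP hb] := @succ_cardinal_bounded m om im (a |` (h @` a)).
  - move=> _ [->//|[c ca <-]]; apply: hP; exact: ord_trans ca aP.
  - apply: card_le_setU => //.
      by apply: countable_card_le => //; apply: countable1.
    apply: card_le_trans (card_image_le _ _) _.
    by have [] := (mem_succ_cardinal om a).1 aP.
  exists b => _; split=> //; first by apply: hb; left.
  by move=> c ca; apply: hb; right; exists c.
pose f n := iter n s x.
have fP n : f n ∈ P by elim: n => [//|n /sP[]].
have [||b bP fb] := @succ_cardinal_bounded m om im (range f).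
- by move=> _ [n _ <-]; apply: fP.
- by apply: countable_card_le => //; apply: card_image_le.
have [||t [ot tE]] := @sup_ord (range f); first exact: small_range.
  by move=> _ [n _ <-]; apply: ord_mem oP (fP n).
have tP z : z ∈ t <-> exists n, z ∈ f n.
  rewrite -[z ∈ t]/(elts t z) tE; split; first by move=> [_ [n _ <-] ?]; exists n.
  by move=> [n zn]; exists (f n) => //; exists n.
have ft n : f n ∈ t by apply/tP; exists n.+1; have [] := sP _ (fP n).
have tP' : t ∈ P.
  apply: ord_le_lt ot oP _ (bP) => z /tP[n zn].
  by apply: ord_trans zn _; [apply: ord_mem bP|apply: fb; exists n].
exists t; split; last split.
- split.
  + by [].
  + split=> //; split; first by exists x; apply: (ft 0).
    by move=> z /tP[n zn]; exists (f n).
  + by move=> c /tP[n cn]; apply/tP; exists n.+1; have [_ _] := sP _ (fP n); apply.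
- by [].
- exact: mem_sub (ft 0).
Qed.

End Club.

(** * From a Jensen matrix to the square *)

Section Setup.
Variables kappa mu : V.
Hypotheses (rk : regular kappa) (cmu : cardinal mu) (kmu : kappa ∈ mu)
  (cofk : cof mu ∈ kappa).
Let P := succ_cardinal mu.

Lemma mu_ord : is_ordinal mu. Proof. exact: cardinal_ord. Qed.
Lemma mu_inf : infinite_set mu.
Proof.
have [_ [ik _]] := rk; apply: infinite_card_le ik; apply: subset_card_le.
exact: mem_sub mu_ord kmu.
Qed.
Lemma mu_limit : is_limit mu. Proof. exact: cardinal_limit mu_inf. Qed.
Lemma succ_mu_cardinal : cardinal P.
Proof. by have [] := succ_cardinalP mu_ord. Qed.
Lemma succ_mu_ord : is_ordinal P.
Proof. exact: cardinal_ord succ_mu_cardinal. Qed.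
Lemma mem_succ_mu : mu ∈ P.
Proof. by have [] := succ_cardinalP mu_ord. Qed.
Lemma cof_mu_mem : cof mu ∈ mu.
Proof. exact: ord_trans mu_ord cofk kmu. Qed.
Lemma cof_mu_ord : is_ordinal (cof mu). Proof. exact: ord_mem mu_ord cof_mu_mem. Qed.

Lemma cof_mu_inf : infinite_set (cof mu).
Proof. exact: limit_inf (limit_cof mu_limit). Qed.

Lemma cof_mu_card_lt : card_lt (cof mu) kappa.
Proof. by have [[_ ck] _] := rk; apply: ck. Qed.

Lemma square_of_jensen chi x M :
  weak_jensen_matrix kappa mu chi x M -> weak_square kappa mu.
Proof.
move=> [j1 j2 j3 [N_mono N_cont N_cov]].
have [ck [ik _]] := rk.
set N := row_union mu M in N_mono N_cont N_cov.
have NA a : a ∈ P -> N a #<= mu.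
  move=> aP; apply: card_le_bigcup mu_ord mu_inf _ _ _ _ _ _.
    by apply: subset_card_le; apply: mem_sub mu_ord cof_mu_mem.
  by move=> b bc; have [_ [_ [_ []]]] := j1 _ _ aP bc.
have Pinf : infinite_set P by apply: succ_cardinal_inf mu_ord mu_inf.
have mP : mu #<= P by apply: subset_card_le; apply: mem_sub succ_mu_ord mem_succ_mu.
pose W := \bigcup_(a in elts P) N a.
have WP : W #<= P.
  apply: (card_le_bigcup succ_mu_ord Pinf) => // a aP.
  exact: card_le_trans (NA _ aP) mP.
have [g [gP g_inj]] := card_le_inj WP.
have NW a y : a ∈ P -> N a y -> W y by move=> aP Ny; exists a.
have /choice[h hP] : forall a, exists b, a ∈ P ->
    [/\ b ∈ P, forall y, N a y -> g y ∈ b, forall y, N a y -> y ∈ P -> y ∈ b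
      & exists2 c, c ∈ b & N c a].
  move=> a; have [aP|] := EM (a ∈ P); last by exists a.
  have [c cP Nca] := N_cov _ aP.
  have [||b bP hb] := @succ_cardinal_bounded mu mu_ord mu_inf ((g @` N a `|` (N a `&` P)) `|` [set c]).
  - by move=> _ [[[y Ny <-]|[]//]|->//]; apply: gP; apply: NW Ny.
  - have := (card_le_setU mu_ord mu_inf); apply; last first.
      by apply: countable_card_le mu_inf; apply: countable1.
    have := (card_le_setU mu_ord mu_inf); apply.
      exact: card_le_trans (card_image_le _ _) (NA _ aP).
    by apply: card_le_trans (NA _ aP); apply: subset_card_le => y [].
  exists b => _; split=> //.
  - by move=> y Ny; apply: hb; left; left; exists y.
  - by move=> y Ny yP; apply: hb; left; right.
  - by exists c => //; apply: hb; right.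
pose D := [set a | [/\ a ∈ P, is_limit a & forall b, b ∈ a -> h b ∈ a]].
have clD : club D P by apply: club_closed mu_ord mu_inf _ _ => a /hP[].
have NaP a y : D a -> N a y -> y ∈ P -> y ∈ a.
  move=> [aP la ha]; rewrite N_cont // => -[b ba Ny] yP.
  have [_ _ + _] := hP _ (ord_trans succ_mu_ord ba aP).
  by move=> /(_ y Ny yP) /ord_trans; apply=> //; [case: la|apply: ha].
have aN a : D a -> a `<=` N a.
  move=> [aP [oa la] ha] b ba; have [_ _ _ [c cb Ncb]] := hP _ (ord_trans succ_mu_ord ba aP).
  have ca : c ∈ a by apply: ord_trans cb (ha _ ba).
  by apply: N_mono Ncb => //; [apply: ord_trans succ_mu_ord ca aP|apply: mem_sub].
have gN a y : D a -> N a y -> osucc (g y) ∈ a.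
  move=> [aP la ha]; rewrite N_cont // => -[b ba Ny].
  have [_ + _ _] := hP _ (ord_trans succ_mu_ord ba aP).
  move=> /(_ y Ny) gb; apply: limit_osucc => //.
  by apply: ord_trans gb (ha _ ba); case: la.
have /choice[be beP] : forall a, exists b, D a -> kappa `<=` cof a ->
    [/\ b ∈ cof mu, unbounded_in (M a b `&` a) a
      & cofinal_in (small_subsets kappa (M a b) `&` N a) (small_subsets kappa (M a b))].
  move=> a; have [[Da ka]|nDa] := EM (D a /\ kappa `<=` cof a); last first.
    by exists a => ? ?; case: nDa.
  have [aP la ha] := Da; have oa := ord_mem succ_mu_ord aP.
  have [b0 b0c b0P] := j3 _ aP ka.
  suff [b [bc b0b ub]] : exists b, [/\ b ∈ cof mu, b0 `<=` b & unbounded_in (M a b `&` a) a].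
    by exists b => _ _; split=> //; apply: b0P.
  apply: contrapT => nb.
  have /choice[e eP] : forall b, exists e, b ∈ cof mu ->
      e ∈ a /\ forall y, y ∈ M a b -> y ∈ a -> y ∈ e.
    move=> b; have [bc|] := EM (b ∈ cof mu); last by exists b.
    have [b1 [b1c bb1 b0b1]] : exists b1, [/\ b1 ∈ cof mu, b `<=` b1 & b0 `<=` b1].
      have oc := cof_mu_ord.
      have [/(mem_sub (ord_mem oc b0c))|[->|/(mem_sub (ord_mem oc bc))]] :=
        ord_total (ord_mem oc bc) (ord_mem oc b0c); by [exists b0; split|exists b; split].
    apply: contrapT => ne; apply: nb; exists b1; split=> // z za.
    apply: contrapT => nz; apply: ne; exists z => _; split=> // y My ya.
    apply: contrapT => yz; apply: nz; exists y; split; last split=> //.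
      by split=> //; apply: j2 bb1 _ My.
    by apply: ord_notin => //; apply: ord_mem oa _.
  have [||z za ez] := @cof_card_lt_bounded a kappa (e @` cof mu) oa ck ka.
  - by move=> _ [b bc <-]; have [] := eP _ bc.
  - exact: card_lt_le ck (card_image_le _ _) cof_mu_card_lt.
  have [b bc Mz] := aN _ Da _ za; have [_ /(_ z Mz za)] := eP _ bc.
  by apply: mem_asym; apply: ez; exists b.
(* The small members of the rows are listed at successor indices, whose
   cofinality is 1, so that they do not interfere with [M a (be a) `&` a]. *)
exists (fun a => if `[< kappa `<=` cof a >] then mkV (M a (be a) `&` a)
        else get [set y : V | W y /\ osucc (g y) = a]), D; split=> // a Da ka.
case: asboolP => // _; have [bc ub cf] := beP _ Da ka.
rewrite mkVE; last by apply: small_sub (small_elts a) => y [].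
split; first by move=> y [].
split=> // y [yM yk].
have [|z [[[zM zk] Nz] yz]] := cf.2 y; first by split=> // u /yM[].
exists (osucc (g z)); split; first exact: gN Nz.
have [aP [oa _] _] := Da.
have Wz : W z by apply: NW Nz.
have og : is_ordinal (g z) by apply: ord_mem succ_mu_ord (gP _ Wz).
case: asboolP => [ks|_].
  have [_ [_ /(_ _ (mem_osucc (g z)))[u [us gu]]]] := cof_limit (osucc_ord og) ck ik ks.
  by move: us => /osuccP[/mem_asym|ug]//; move: gu; rewrite ug => /mem_irrefl.
suff -> : get [set y | W y /\ osucc (g y) = osucc (g z)] = z by [].
have [Wu /osucc_inj gu] : [set y | W y /\ osucc (g y) = osucc (g z)] (get [set y | W y /\ osucc (g y) = osucc (g z)]).
  by apply: getPex; exists z.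
exact: g_inj.
Qed.

End Setup.

(** * Hulls and elementary submodels *)

Inductive hull (F : nat -> seq V -> V) (X : set V) : V -> Prop :=
| hull_gen y : X y -> hull F X y
| hull_app n s : (forall y, y \in s -> hull F X y) -> hull F X (F n s).

Section Hull.
Variable F : nat -> seq V -> V.

Lemma hull_sub (X A : set V) : X `<=` A ->
  (forall n s, (forall y, y \in s -> A y) -> A (F n s)) -> hull F X `<=` A.
Proof. by move=> XA FA y; elim=> [|n s _]; [exact: XA|exact: FA]. Qed.

Lemma hull_mono (X Y : set V) : X `<=` Y -> hull F X `<=` hull F Y.
Proof.
by move=> XY; apply: hull_sub => [y /XY|n s]; [exact: hull_gen|exact: hull_app].
Qed.

Lemma hull_finite (X : set V) y : hull F X y ->
  exists s : seq V, (forall z, z \in s -> X z) /\ hull F [set` s] y.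
Proof.
elim=> {y} [y Xy|n s _ IH].
  exists [:: y]; split; first by move=> z; rewrite inE => /eqP->.
  by apply: hull_gen; rewrite /= mem_head.
suff [t [tX ts]] : exists t : seq V, (forall z, z \in t -> X z) /\
    forall y, y \in s -> hull F [set` t] y.
  by exists t; split=> //; apply: hull_app.
elim: s IH => [|y s IHs] IH; first by exists [::].
have [t [tX ts]] := IHs (fun z (zs : z \in behead (y :: s)) => IH z (mem_behead zs)).
have [u [uX uy]] := IH y (mem_head _ _).
exists (u ++ t); split=> z; first by rewrite mem_cat => /orP[/uX|/tX].
rewrite inE => /predU1P[->|/ts]; last first.
  by apply: hull_mono => w /= wt; rewrite mem_cat wt orbT.
by apply: hull_mono uy => w /= wu; rewrite mem_cat wu.
Qed.

Lemma hull_card_le (a : V) (X : set V) : is_ordinal a -> infinite_set a ->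
  X #<= a -> hull F X #<= a.
Proof.
move=> oa ia Xa.
pose step (A : set V) := A `|` [set y | exists n s, (forall z, z \in s -> A z) /\ y = F n s].
pose lev k := iter k step X.
have lev_mono k l : (k <= l)%N -> lev k `<=` lev l.
  by move=> /subnKC <-; elim: (l - k)%N => [|j IH]; rewrite ?addn0 // addnS => y /IH; left.
apply: card_le_trans (_ : \bigcup_(k in [set: nat]) lev k #<= a).
  apply: subset_card_le; apply: hull_sub => [y Xy|n s sl]; first by exists 0%N.
  suff [k sk] : exists k, forall y, y \in s -> lev k y.
    by exists k.+1 => //; right; exists n, s.
  elim: s sl => [|y s IHs] sl; first by exists 0%N.
  have [k sk] := IHs (fun z (zs : z \in behead (y :: s)) => sl z (mem_behead zs)).
  have [l _ yl] := sl y (mem_head _ _).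
  exists (maxn k l) => z; rewrite inE => /predU1P[->|/sk].
    by apply: lev_mono yl; apply: leq_maxr.
  by apply: lev_mono; apply: leq_maxl.
apply: card_le_bigcup => //; first exact: countable_card_le.
elim=> [//|k IH _]; apply: card_le_setU => //; first exact: IH.
apply: (@card_le_binary a oa ia _ _ _ F [set: nat] _ _ _ _ (card_le_seq oa ia (IH I))).
  by move=> y [n [s [sl ->]]]; exists n, s.
exact: countable_card_le.
Qed.

End Hull.

Fixpoint formula_code (phi : formula) : nat :=
  pickle (match phi with
  | FMem i j => (0, (i, j))
  | FEq i j => (1, (i, j))
  | FNot p => (2, (formula_code p, 0))
  | FAnd p q => (3, (formula_code p, formula_code q))
  | FAll i p => (4, (i, formula_code p))
  end)%N.

Lemma formula_code_inj : injective formula_code.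
Proof.
have pI := pcan_inj (@pickleK (nat * (nat * nat))%type).
elim=> [i j|i j|p IHp|p IHp q IHq|i p IHp] [k l|k l|r|r t|k r] //= /pI[] //.
- by move=> -> ->.
- by move=> -> ->.
- by move=> /IHp->.
- by move=> /IHp-> /IHq->.
- by move=> -> /IHp->.
Qed.

Lemma sat_ext (phi : formula) : exists N, forall B v w,
  (forall n, (n < N)%N -> v n = w n) -> (sat B v phi <-> sat B w phi).
Proof.
elim: phi => [i j|i j|p [N IH]|p [N IHp] q [K IHq]|i p [N IH]] /=.
- by exists (maxn i j).+1 => B v w vw; rewrite !vw // ltnS (leq_maxl, leq_maxr).
- by exists (maxn i j).+1 => B v w vw; rewrite !vw // ltnS (leq_maxl, leq_maxr).
- by exists N => B v w /IH-> .
- exists (maxn N K) => B v w vw; rewrite (IHp B v w) ?(IHq B v w) //.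
    by move=> n nK; apply: vw; rewrite leq_max nK orbT.
  by move=> n nN; apply: vw; rewrite leq_max nN.
- exists N => B v w vw; split=> h a /h; apply: (IH _ _ _ _).1 => n /vw /= e;
  by case: eqP.
Qed.

Definition skolem (B : set V) (x0 : V) (n : nat) (s : seq V) : V :=
  xget x0 [set a | B a /\ exists phi i, n = pickle (formula_code phi, i) /\
                   ~ sat B [eta nth x0 s with i |-> a] phi].

Lemma skolem_in (B : set V) x0 n s : B x0 -> B (skolem B x0 n s).
Proof. by rewrite /skolem => Bx0; case: xgetP => // a _ []. Qed.

Lemma tarski_vaught (A B : set V) x0 : A x0 -> A `<=` B ->
  (forall n s, (forall y, y \in s -> A y) -> A (skolem B x0 n s)) ->
  elementary_submodel A B.
Proof.
move=> Ax0 AB skA; split; [by exists x0|split=> //].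
elim=> [i j|i j|p IH|p IHp q IHq|i p IH] v vA //=.
- by rewrite IH.
- by rewrite IHp // IHq.
have vA' a : A a -> forall n, A ([eta v with i |-> a] n).
  by move=> Aa n /=; case: eqP.
split=> [h b Bb|h a Aa]; last by apply/IH; [exact: vA'|apply: h; apply: AB].
apply: contrapT => nb; have [N Np] := sat_ext p.
pose s := mkseq v N.
have vs a : sat B [eta v with i |-> a] p <-> sat B [eta nth x0 s with i |-> a] p.
  by apply: Np => n nN /=; case: eqP => // _; rewrite nth_mkseq.
have As y : y \in s -> A y by move=> /mapP[n _ ->].
have := skA (pickle (formula_code p, i)) s As; rewrite /skolem; case: xgetP; last first.
  by move=> /(_ b) []; split=> //; exists p, i; rewrite -vs.
move=> a _ [Ba [p' [i' [/(pcan_inj pickleK)[/formula_code_inj <- <-]]]]].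
by rewrite -vs => na Aa; apply: na; apply/IH; [exact: vA'|exact: h].
Qed.

Section HereditarySize.
Variables chi t : V.
Hypotheses (rchi : regular chi) (tchi : t ∈ chi) (it : infinite_set t).

Lemma H_ordinal (a : V) : a ∈ chi -> is_ordinal a -> H chi a.
Proof.
move=> ac oa; have [cc _] := rchi; apply/card_ltP => //; exists a; split=> //.
by apply: subset_card_le; apply: smallest_sub => //; case: oa.
Qed.

Lemma H_set (x : V) : x `<=` H chi -> card_lt x chi -> H chi x.
Proof.
move=> xH xc; have [cc [ic _]] := rchi.
have tcx : transitive_closure x `<=`
    \bigcup_(y in elts x) ([set y] `|` transitive_closure y).
  apply: smallest_sub => [|y yx]; last by exists y => //; left.
  move=> u [y yx [->|uy]] w wu; exists y => //; right.
    exact: sub_gen_smallest wu.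
  by move=> A [tA yA]; apply: (tA u) => //; apply: uy.
apply: (card_lt_le cc (subset_card_le tcx)).
apply: card_lt_bigcup rchi tchi it xc _ => y /xH/(card_ltP _ cc)[l [lc yl]].
have [d [dc ld td]] := limit_max (cardinal_limit cc ic) lc tchi.
have od := ord_mem (cardinal_ord cc) dc.
have id : infinite_set d.
  by apply: infinite_card_le it; apply: subset_card_le; apply: mem_sub.
apply/card_ltP => //; exists d; split=> //; apply: card_le_setU => //.
  by apply: countable_card_le => //; apply: countable1.
by apply: card_le_trans yl _; apply: subset_card_le; apply: mem_sub.
Qed.

End HereditarySize.

(** * From the square to a Jensen matrix *)

Lemma enumeration (l : V) : exists en : V -> V -> V,
  forall y : V, elts y !=set0 -> y #<= l -> en y @` l = y.
Proof.
suff /choice[en enP] : forall y : V, exists f : V -> V,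
    elts y !=set0 -> y #<= l -> f @` l = y by exists en.
move=> y; have [[z zy]|y0] := EM (elts y !=set0); last by exists id.
have [/card_le_cover[f fP]|yl] := EM (y #<= l); last by exists id.
exists (fun i => if `[< f i ∈ y >] then f i else z) => _ _.
apply/seteqP; split=> [_ [i _ <-]|u uy]; first by case: asboolP.
by have [i il fi] := fP _ uy; exists i => //; rewrite fi; case: asboolP.
Qed.

Section Construction.
Variables kappa mu : V.
Hypotheses (rk : regular kappa) (cmu : cardinal mu) (kmu : kappa ∈ mu)
  (cofk : cof mu ∈ kappa).
Let P := succ_cardinal mu.

Variables chi x0 : V.
Hypotheses (rchi : regular chi) (Pchi : P `<=` chi) (Hx0 : H chi x0).

Variables (enk enm : V -> V -> V).
Hypothesis enkP : forall y : V, elts y !=set0 -> y #<= kappa -> enk y @` kappa = y.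
Hypothesis enmP : forall y : V, elts y !=set0 -> y #<= mu -> enm y @` mu = y.

Variables (C : V -> V) (K : V -> set V) (good : set V) (nu : V -> V) (ev : V -> V -> V).
Hypothesis goodP : forall a, good a ->
  [/\ a ∈ P, kappa `<=` cof a, C a `<=` a, K a `<=` C a & unbounded_in (K a) a].
Hypothesis Kcard : forall a, good a -> exists2 l, l ∈ mu & K a #<= l.
Hypothesis Ccover : forall a x, good a -> small_subsets kappa (C a) x ->
  exists a', [/\ a' ∈ a, x `<=` C a' & card_lt (C a') kappa].
Hypothesis nuP : forall b, b ∈ cof mu -> nu b ∈ mu /\ kappa ∈ nu b.
Hypothesis nu_mono : forall b b', b ∈ cof mu -> b' ∈ cof mu -> b `<=` b' ->
  nu b `<=` nu b'.
Hypothesis nu_cov : forall z, z ∈ mu -> exists2 b, b ∈ cof mu & z ∈ nu b.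
Hypothesis evP : forall b i, b ∈ cof mu -> i ∈ mu ->
  ev b i `<=` nu b /\ card_lt (ev b i) kappa.
Hypothesis ev_cov : forall b w, b ∈ cof mu -> small_subsets kappa (nu b) w ->
  exists2 i, i ∈ mu & w `<=` ev b i.

(* Apart from constants and Skolem functions, symbol 1 enumerates the set [C a]
   along [kappa], and symbol 2 enumerates the stage [M a] along [mu]; the latter
   only for [a ∈ g], so that [lang M g] is determined by the stages below [g]. *)
Definition lang (M : V -> V) (g : V) (n : nat) (s : seq V) : V :=
  match n, s with
  | 0, _ => x0
  | 1, [:: a; b] => if `[< H chi (enk (C a) b) >] then enk (C a) b else x0
  | 2, [:: a; b] => if `[< a ∈ g /\ b ∈ mu >] then enm (M a) b else x0
  | n.+3, s => skolem (H chi) x0 n s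
  | _, _ => x0
  end.

Definition approx (M : V -> V) (a g e : V) : V :=
  mkV (hull (lang M g) ((C a `&` g) `|` e)).

(* The sets [approx M a d (ev b i)] will witness cofinality in the limit rows. *)
Definition gens (M : V -> V) (g : V) : set V :=
  mu `|` \bigcup_(d in elts g) (M d `|` [set d] `|`
    [set e | H chi e /\ exists a b i,
       [/\ a ∈ d, b ∈ cof mu, i ∈ mu & e = approx M a d (ev b i)]]).

Let chainE : exists M : V -> V, forall g, is_ordinal g ->
  M g = mkV (hull (lang M g) (gens M g)).
Proof.
have [M ME] := mem_rec (fun g M => mkV (hull (lang M g) (gens M g))).
exists M => g og; rewrite {1}ME.
set M' := fun y => _; have M'E y : y ∈ g -> M' y = M y by rewrite /M'; case: asboolP.
have langE d : (forall y, y ∈ d -> y ∈ g) -> lang M' d = lang M d.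
  move=> dg; apply/funext=> n; apply/funext => s; rewrite /lang.
  case: n => [//|[//|[|//]]]; case: s => [//|a [//|b [|//]]].
  by case: asboolP => // -[/dg/M'E->].
congr mkV; rewrite langE //; congr hull; rewrite /gens; congr setU.
apply: eq_bigcupr => d dg; rewrite M'E //; congr setU.
have dsub : forall y, y ∈ d -> y ∈ g by move=> y yd; apply: ord_trans yd dg.
by rewrite /approx langE.
Qed.

Let M := sval (cid chainE).
Let F := lang M.
Let ME g : is_ordinal g -> M g = mkV (hull (F g) (gens M g)).
Proof. exact: (svalP (cid chainE)). Qed.

Let omu := mu_ord cmu.
Let imu := mu_inf rk cmu kmu.
Let oP := succ_mu_ord cmu.
Let muP := mem_succ_mu cmu.
Let cchi : cardinal chi. Proof. by have [] := rchi. Qed.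
Let muchi : mu ∈ chi. Proof. exact: Pchi muP. Qed.
Let cmu_lt : cof mu ∈ mu. Proof. exact: cof_mu_mem cmu kmu cofk. Qed.
Let card_mem l a : is_ordinal a -> l ∈ a -> l #<= a.
Proof. by move=> oa la; apply: subset_card_le; apply: mem_sub. Qed.
Let P_card a : a ∈ P -> a #<= mu.
Proof. by move=> aP; have [] := (mem_succ_cardinal omu a).1 aP. Qed.
Let P_H a : a ∈ P -> H chi a.
Proof. by move=> aP; apply: H_ordinal => //; [apply: Pchi|apply: ord_mem oP aP]. Qed.
Let mu_H a : a ∈ mu -> H chi a.
Proof. by move=> am; apply: P_H; apply: ord_trans am muP. Qed.

Lemma lang_H g n s : (forall a, a ∈ g -> enm (M a) @` mu `<=` H chi) ->
  H chi (F g n s).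
Proof.
move=> gH; case: n => [//|[|[|n]]]; rewrite /F /=; last exact: skolem_in.
  by case: s => [//|a [//|b [|//]]]; case: asboolP.
by case: s => [//|a [//|b [|//]]]; case: asboolP => // -[/gH + bm]; apply; exists b.
Qed.

Lemma chainP g : g ∈ P -> [/\ elts (M g) = hull (F g) (gens M g),
  M g `<=` H chi, M g #<= mu & enm (M g) @` mu = M g].
Proof.
elim: (mem_wf g) => {}g _ IH gP.
have gIH a : a ∈ g -> M a `<=` H chi /\ M a #<= mu /\ enm (M a) @` mu = M a.
  by move=> ag; have [] := IH a ag (ord_trans oP ag gP).
have og : is_ordinal g := ord_mem oP gP.
have gc : gens M g #<= mu.
  apply: card_le_setU => //; apply: card_le_bigcup => //; first exact: P_card.
  move=> d dg; apply: card_le_setU => //; first apply: card_le_setU => //.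
  - by have [_ []] := gIH _ dg.
  - by apply: countable_card_le => //; apply: countable1.
  apply: (@card_le_binary mu omu imu V (V * V)%type V
    (fun a p => approx M a d (ev p.1 p.2)) d (cof mu `*` mu)).
  - by move=> e [_ [a [b [i [ad bc im ->]]]]]; exists a, (b, i).
  - by apply: P_card; apply: ord_trans dg gP.
  - apply: card_le_trans (card_le_sqr omu imu).
    by apply: card_le_setX => //; apply: card_mem.
have hc : hull (F g) (gens M g) #<= mu by apply: hull_card_le.
have hE : elts (M g) = hull (F g) (gens M g).
  by rewrite ME // mkVE //; apply: small_card_le hc.
split=> //; rewrite ?hE //.
  apply: hull_sub => [y [/mu_H//|[d dg]]|n s _].
    move=> [[yM|->]|[]//]; last by apply: P_H; apply: ord_trans dg gP.
    by have [+ _] := gIH _ dg; apply.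
  by apply: lang_H => a ag; have [aH [_ ->]] := gIH _ ag.
rewrite enmP ?hE //; exists x0.
exact: (@hull_app _ _ 0%N [::]).
Qed.

Let M_app g n s : g ∈ P -> (forall y, y \in s -> y ∈ M g) -> F g n s ∈ M g.
Proof.
move=> gP; have [E _ _ _] := chainP gP; rewrite -[_ ∈ _]/(elts (M g) _) E => sM.
by apply: hull_app => y /sM; rewrite -[y ∈ _]/(elts (M g) _) E.
Qed.

Let M_gen g y : g ∈ P -> gens M g y -> y ∈ M g.
Proof.
move=> gP; have [E _ _ _] := chainP gP; rewrite -[_ ∈ _]/(elts (M g) _) E.
exact: hull_gen.
Qed.

Let M_mu g : g ∈ P -> mu `<=` M g.
Proof. by move=> gP y ym; apply: M_gen => //; left. Qed.

Let M_sub d g : g ∈ P -> d ∈ g -> M d `<=` M g.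
Proof. by move=> gP dg y yd; apply: M_gen => //; right; exists d => //; left; left. Qed.

Let M_mem d g : g ∈ P -> d ∈ g -> d ∈ M g.
Proof. by move=> gP dg; apply: M_gen => //; right; exists d => //; left; right. Qed.

Let M_approx d g a b i : g ∈ P -> d ∈ g -> a ∈ d -> b ∈ cof mu -> i ∈ mu ->
  H chi (approx M a d (ev b i)) -> approx M a d (ev b i) ∈ M g.
Proof.
move=> gP dg ad bc im He; apply: M_gen => //; right; exists d => //; right.
by split=> //; exists a, b, i.
Qed.

Let F_restrict (d g : V) n s : d `<=` g -> (forall a, a \in s -> a ∈ g -> a ∈ d) ->
  F g n s = F d n s.
Proof.
move=> dg sd; case: n => [//|[//|[|//]]]; case: s sd => [//|a [//|b [|//]]] sd.
rewrite /F /=; case: asboolP => [[ag bm]|nag]; case: asboolP => //.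
  by case; split=> //; apply: sd => //; apply: mem_head.
by move=> [/dg ag bm]; case: nag.
Qed.

Let F_sub (d g : V) n s : d `<=` g -> F d n s = F g n s \/ F d n s = x0.
Proof.
move=> dg; case: n => [|[|[|n]]]; try by [left|right].
case: s => [|a [|b [|]]]; try by [left|right].
rewrite /F /=; case: asboolP => [[ag bm]|_]; last by right.
by left; case: asboolP => // -[]; split=> //; apply: dg.
Qed.

Lemma chain_limit g : g ∈ P -> is_limit g -> M g = \bigcup_(d in elts g) M d :> set V.
Proof.
move=> gP lg; have [E _ _ _] := chainP gP; have [og [[z zg] _]] := lg.
have gP' d : d ∈ g -> d ∈ P by move=> dg; apply: ord_trans dg gP.
apply/seteqP; split; last by move=> y [d dg]; apply: M_sub.
rewrite E; apply: hull_sub => [y [ym|[d dg dy]]|n s sM].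
- by exists z => //; apply: M_mu ym; apply: gP'.
- have sdg := limit_osucc lg dg; exists (osucc d) => //.
  by apply: M_gen; [exact: gP'|right; exists d => //; apply: mem_osucc].
suff [d [dg sd sg]] : exists d, [/\ d ∈ g, forall y, y \in s -> y ∈ M d
    & forall y, y \in s -> y ∈ g -> y ∈ d].
  exists d => //; rewrite (F_restrict (d := d)) //; last exact: mem_sub.
  by apply: M_app => //; apply: gP'.
elim: s sM => [|y s IHs] sM; first by exists z.
have [d [dg sd sg]] := IHs (fun y' (ys : y' \in behead (y :: s)) => sM y' (mem_behead ys)).
have [c cg yc] := sM y (mem_head _ _).
have [e [eg de ce]] := limit_max lg dg cg.
have [f [fg ef yf]] : exists f, [/\ f ∈ g, e ∈ f & y ∈ g -> y ∈ f].
  have [yg|yg] := EM (y ∈ g).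
    by have [f [fg ef yf]] := limit_max lg eg yg; exists f.
  by exists (osucc e); split=> //; [exact: limit_osucc|exact: mem_osucc].
have of_ := ord_mem og fg; have fP := gP' _ fg.
have [df cf] := (ord_trans of_ de ef, ord_trans of_ ce ef).
exists f; split=> // z'; rewrite inE => /predU1P[->//|].
- exact: M_sub yc.
- by move=> /sd; apply: M_sub.
- by move=> /sg h /h z'd; apply: ord_trans z'd df.
Qed.

(* Unless [good a], no cofinality is required of the row [a], and any increasing
   filtration of [M a] will do. *)
Definition seed (a b : V) : set V :=
  nu b `|` (if `[< good a >] then K a else enm (M a) @` nu b).

Definition cell (a b : V) : V := mkV (hull (F a) (seed a b)).

Let nu_mu b : b ∈ cof mu -> nu b `<=` mu.
Proof. by move=> /nuP[/(mem_sub omu)]. Qed.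

Let kappa_inf : infinite_set kappa. Proof. by have [_ []] := rk. Qed.

Let nu_inf (b d : V) : b ∈ cof mu -> is_ordinal d -> nu b ∈ d -> infinite_set d.
Proof.
move=> /nuP[_ kb] od bd; apply: infinite_card_le kappa_inf.
by apply: card_mem => //; apply: ord_trans kb bd.
Qed.

Let cellP a b : a ∈ P -> b ∈ cof mu ->
  elts (cell a b) = hull (F a) (seed a b) /\ card_lt (cell a b) mu.
Proof.
move=> aP bc; have [nbm _] := nuP bc.
have [l lm Kl] : exists2 l, l ∈ mu & (if `[< good a >] then K a else enm (M a) @` nu b) #<= l.
  by case: asboolP => [/Kcard//|_]; exists (nu b) => //; apply: card_image_le.
have [d [dm ld bd]] := limit_max (mu_limit rk cmu kmu) lm nbm.
have od := ord_mem omu dm; have id := nu_inf bc od bd.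
have hd : hull (F a) (seed a b) #<= d.
  apply: hull_card_le => //; apply: card_le_setU => //; first exact: card_mem.
  by apply: card_le_trans Kl _; apply: card_mem.
have E : elts (cell a b) = hull (F a) (seed a b) by rewrite mkVE //; apply: small_card_le hd.
by split=> //; apply/card_ltP => //; exists d; rewrite E.
Qed.

Let cell_gen a b y : a ∈ P -> b ∈ cof mu -> seed a b y -> y ∈ cell a b.
Proof.
move=> aP bc; have [E _] := cellP aP bc; rewrite -[_ ∈ _]/(elts (cell a b) _) E.
exact: hull_gen.
Qed.

Let cell_app a b n s : a ∈ P -> b ∈ cof mu ->
  (forall y, y \in s -> y ∈ cell a b) -> F a n s ∈ cell a b.
Proof.
move=> aP bc; have [E _] := cellP aP bc; rewrite -[F _ _ _ ∈ _]/(elts (cell a b) _) E => sQ.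
by apply: hull_app => y /sQ; rewrite -[_ ∈ _]/(elts (cell a b) _) E.
Qed.

Let cell_nu a b : a ∈ P -> b ∈ cof mu -> nu b `<=` cell a b.
Proof. by move=> aP bc y yb; apply: cell_gen => //; left. Qed.

Let seed_M a b : a ∈ P -> b ∈ cof mu -> seed a b `<=` M a.
Proof.
move=> aP bc y [/(nu_mu bc)|]; first exact: M_mu.
case: asboolP => [ga|_].
  by have [_ _ Ca KC _] := goodP ga; move=> /KC/Ca; apply: M_mem.
move=> [i /(nu_mu bc) im <-]; have [_ _ _ <-] := chainP aP.
by exists i.
Qed.

Let cell_M a b : a ∈ P -> b ∈ cof mu -> cell a b `<=` M a.
Proof.
move=> aP bc; have [-> _] := cellP aP bc.
by apply: hull_sub; [exact: seed_M|move=> n s; apply: M_app].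
Qed.

Lemma cell_elementary a b : a ∈ P -> b ∈ cof mu ->
  elementary_submodel (cell a b) (H chi) /\ x0 ∈ cell a b /\
  kappa `|` [set kappa] `<=` cell a b /\ card_lt (cell a b) mu.
Proof.
move=> aP bc; have [_ Qmu] := cellP aP bc.
have x0Q : x0 ∈ cell a b by apply: (@cell_app a b 0%N [::]).
split.
  apply: (@tarski_vaught _ _ x0) => //.
    by have [_ MH _ _] := chainP aP; apply: subset_trans (cell_M aP bc) MH.
  by move=> n s sQ; apply: (@cell_app a b n.+3 s).
split=> //; split=> //.
have [nbm kb] := nuP bc; have onb := ord_mem omu nbm.
by move=> y [yk|->]; apply: (cell_nu aP bc) => //; apply: ord_trans yk kb.
Qed.

Lemma cell_mono a b b' : a ∈ P -> b ∈ cof mu -> b' ∈ cof mu -> b `<=` b' ->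
  cell a b `<=` cell a b'.
Proof.
move=> aP bc bc' bb; have [-> _] := cellP aP bc; have [-> _] := cellP aP bc'.
apply: hull_mono => y [yb|]; first by left; apply: nu_mono yb.
by rewrite /seed; case: asboolP => [_ Ky|_ [i ib <-]]; right=> //; exists i => //; apply: nu_mono ib.
Qed.

Let good_limit a : good a -> is_limit a.
Proof.
move=> /goodP[aP ka _ _ _]; have [ck _] := rk.
by apply: cof_limit ck kappa_inf ka; apply: ord_mem aP.
Qed.

Lemma cell_row a : a ∈ P -> row_union mu cell a = M a.
Proof.
move=> aP; have [_ _ _ ME'] := chainP aP.
apply/seteqP; split=> [y [b bc]|y yM]; first exact: cell_M.
have [ga|nga] := EM (good a); last first.
  move: yM; rewrite -ME' => -[i im iy].
  have [b bc ib] := nu_cov im; exists b => //; apply: cell_gen => //.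
  by right; case: asboolP => // _; exists i.
have [_ _ Ca KC Ku] := goodP ga.
move: yM; rewrite chain_limit //; last exact: good_limit.
move=> [d da yd]; have [e [Ke [ea de]]] := Ku _ da.
have eP := ord_trans oP ea aP; have oe := ord_mem oP eP.
have ye : y ∈ M e.
  have [de'|<-//] := ord_subE (ord_mem oP (ord_trans oP da aP)) oe de.
  exact: M_sub de' _ yd.
have [_ _ _ Me] := chainP eP.
move: ye; rewrite -[y ∈ _]/(elts (M e) y) -Me => -[i im <-].
have [b bc ib] := nu_cov im; exists b => //.
have <- : F a 2 [:: e; i] = enm (M e) i by rewrite /F /=; case: asboolP => // -[].
apply: cell_app => // z; rewrite !inE => /orP[] /eqP->; apply: cell_gen => //; last by left.
by right; case: asboolP.
Qed.

Lemma cell_continuous a : a ∈ P -> is_limit a ->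
  row_union mu cell a = \bigcup_(d in elts a) row_union mu cell d.
Proof.
move=> aP la; rewrite cell_row // chain_limit //; apply: eq_bigcupr => d da.
by rewrite cell_row //; apply: ord_trans da aP.
Qed.

Lemma cell_row_mono a a' : a ∈ P -> a' ∈ P -> a `<=` a' ->
  row_union mu cell a `<=` row_union mu cell a'.
Proof.
move=> aP aP' aa; rewrite !cell_row //.
have [|->//] := ord_subE (ord_mem oP aP) (ord_mem oP aP') aa.
exact: M_sub.
Qed.

Lemma cell_row_mem a a' : a' ∈ P -> a ∈ a' -> row_union mu cell a' a.
Proof. by move=> aP' aa; rewrite cell_row //; apply: M_mem. Qed.

Let card_lt_kappaU (A B : set V) :
  card_lt A kappa -> card_lt B kappa -> card_lt (A `|` B) kappa.
Proof.
have [ck _] := rk; have lk := cardinal_limit ck kappa_inf.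
move=> /(card_ltP _ ck)[l [lk' Al]] /(card_ltP _ ck)[k [kk Bk]].
have [d [dk ld kd]] := limit_max lk lk' kk.
have [e [ek de ce]] := limit_max lk dk cofk.
have oe := ord_mem (cardinal_ord ck) ek.
have ie : infinite_set e.
  by apply: infinite_card_le (cof_mu_inf rk cmu kmu); apply: card_mem.
apply/card_ltP => //; exists e; split=> //; apply: card_le_setU => //.
  by apply: card_le_trans Al _; apply: card_mem => //; apply: ord_trans de.
by apply: card_le_trans Bk _; apply: card_mem => //; apply: ord_trans de.
Qed.

Let hull_card_lt G (A : set V) : card_lt A kappa -> card_lt (hull G A) kappa.
Proof.
have [ck _] := rk => /(card_ltP _ ck)[l [lk Al]].
have [d [dk ld cd]] := limit_max (cardinal_limit ck kappa_inf) lk cofk.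
have od := ord_mem (cardinal_ord ck) dk.
have id : infinite_set d.
  by apply: infinite_card_le (cof_mu_inf rk cmu kmu); apply: card_mem.
apply/card_ltP => //; exists d; split=> //; apply: hull_card_le => //.
by apply: card_le_trans Al _; apply: card_mem.
Qed.

Lemma cell_cofinal a : good a -> exists2 b0 : V, b0 ∈ cof mu &
  forall b : V, b ∈ cof mu -> b0 `<=` b ->
    cofinal_in (small_subsets kappa (cell a b) `&` row_union mu cell a)
               (small_subsets kappa (cell a b)).
Proof.
move=> ga; have [aP ka Ca KC Ku] := goodP ga; have la := good_limit ga.
have [ck _] := rk; have [oa [[z0 z0a] _]] := la.
have icof := cof_mu_inf rk cmu kmu.
have [b0 b0c b0P] : exists2 b0, b0 ∈ cof mu & forall x, small_subsets kappa (K a) x ->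
    exists a', [/\ a' ∈ a, a' ∈ cell a b0, x `<=` C a' & card_lt (C a') kappa].
  (* Otherwise choose a counterexample for each column: since [cof mu < kappa],
     their union is small, and the index of its cover lies in some column. *)
  apply: contrapT => nb.
  have /choice[w wP] : forall b, exists w, b ∈ cof mu -> small_subsets kappa (K a) w /\
      ~ exists a', [/\ a' ∈ a, a' ∈ cell a b, w `<=` C a' & card_lt (C a') kappa].
    move=> b; have [bc|] := EM (b ∈ cof mu); last by exists b.
    apply: contrapT => nw; apply: nb; exists b => // x xK.
    by apply: contrapT => na; apply: nw; exists x.
  have Wk : card_lt (\bigcup_(b in elts (cof mu)) w b) kappa.
    apply: card_lt_bigcup rk cofk icof (cof_mu_card_lt rk cofk) _ => b bc.
    by have [[]] := wP _ bc.
  have sW := card_lt_small Wk.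
  have [|a' [aa' WC Ck]] := @Ccover a (mkV (\bigcup_(b in elts (cof mu)) w b)) ga.
    by rewrite /small_subsets /= mkVE //; split=> // y [b bc yw]; apply: KC; have [[+ _] _] := wP _ bc; apply.
  have : row_union mu cell a a' by apply: cell_row_mem.
  move=> [b bc a'Q]; have [_ []] := wP _ bc; exists a'; split=> //.
  by apply: subset_trans WC; rewrite mkVE // => y yw; exists b.
exists b0 => // b bc b0b; split=> [y []//|y [yQ yk]].
have [E _] := cellP aP bc.
have /choice[s sP] : forall z, exists s : seq V, z ∈ y ->
    (forall u, u \in s -> seed a b u) /\ hull (F a) [set` s] z.
  move=> z; have [/yQ|] := EM (z ∈ y); last by exists [::].
  by rewrite E => /hull_finite[s sP]; exists s.
pose U := \bigcup_(z in elts y) [set` s z].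
have Uk : card_lt U kappa.
  by apply: card_lt_bigcup rk cofk icof yk _ => z _; apply: card_lt_finite.
have seedE : seed a b = nu b `|` K a by rewrite /seed; case: asboolP.
have Useed : U `<=` seed a b by move=> u [z zy us]; have [+ _] := sP _ zy; apply.
have part (A : set V) : small_subsets kappa A (mkV (U `&` A)).
  have sm : small (U `&` A) by apply: small_sub (card_lt_small Uk) => u [].
  rewrite /small_subsets /= mkVE //; split; first by move=> u [].
  by apply: card_lt_le ck _ Uk; apply: subset_card_le => u [].
have smU (A : set V) : small (U `&` A) by apply: small_sub (card_lt_small Uk) => u [].
have [a' [a'a a'Q UC Ck]] := b0P _ (part (K a)).
have [i im Ue] := ev_cov bc (part (nu b)).
have [evnu evk] := evP bc im.
pose Y := hull (F a) U.
have Yk : card_lt Y kappa by exact: hull_card_lt.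
have [|e1 e1a Ye] := @cof_card_lt_bounded a kappa (Y `&` a) oa ck ka (@subIsetr _ _ _).
  by apply: card_lt_le ck _ Yk; apply: subset_card_le => u [].
(* Beyond [e] the hull [Y] contains no index below [a], so symbol 2 acts on [Y]
   in the same way in [F e] and in [F a]. *)
have [e [ea e1e a'e]] := limit_max la e1a a'a.
have eP := ord_trans oP ea aP; have oe := ord_mem oa ea.
have esub : e `<=` a by apply: mem_sub.
have Ye' u : Y u -> u ∈ a -> u ∈ e.
  by move=> Yu ua; apply: ord_trans e1e => //; apply: Ye.
pose X := C a' `&` e `|` ev b i.
have UX : U `<=` X.
  move=> u Uu; have := Useed _ Uu; rewrite seedE => -[un|uK].
    by right; apply: Ue; rewrite mkVE.
  left; split; first by apply: UC; rewrite mkVE.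
  by apply: Ye'; [exact: hull_gen|apply: Ca; apply: KC].
have YX : Y `<=` hull (F e) X.
  suff YX : Y `<=` Y `&` hull (F e) X by move=> u /YX[].
  apply: hull_sub => [u Uu|n t tY]; first by split; apply: hull_gen => //; apply: UX.
  split; first by apply: hull_app => u /tY[].
  rewrite (F_restrict (d := e)) //; first by apply: hull_app => u /tY[].
  by move=> u /tY[Yu _]; apply: Ye'.
have Qb0 := cell_mono aP b0c bc b0b.
have XQ : X `<=` cell a b.
  move=> u [[uC ue]|/evnu]; last exact: cell_nu.
  have CE := enkP (ex_intro _ u uC) Ck.1.
  move: (uC); rewrite -CE => -[j jk ju].
  have <- : F a 1 [:: a'; j] = u.
    by rewrite /F /= ju; case: asboolP => // -[]; apply: P_H; apply: ord_trans ue eP.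
  apply: cell_app => // v; rewrite !inE => /orP[] /eqP->; first exact: Qb0.
  by have [_ [_ [+ _]]] := cell_elementary aP bc; apply; left.
have hXQ : hull (F e) X `<=` cell a b.
  apply: hull_sub => // n t tQ; have [->|->] := F_sub n t esub; first exact: cell_app.
  by have [_ []] := cell_elementary aP bc.
have hXk : card_lt (hull (F e) X) kappa.
  apply/hull_card_lt/card_lt_kappaU => //.
  by apply: card_lt_le ck _ Ck; apply: subset_card_le => u [].
have hE : elts (approx M a' e (ev b i)) = hull (F e) X.
  by rewrite /approx mkVE //; apply: card_lt_small hXk.
exists (approx M a' e (ev b i)); rewrite /small_subsets /= hE; split.
  split; first by split.
  rewrite cell_row //; apply: M_approx => //; apply: (H_set rchi muchi imu).
    rewrite hE; apply: subset_trans hXQ _.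
    by have [[_ []]] := cell_elementary aP bc.
  rewrite hE; apply/card_ltP => //; exists mu; split=> //.
  by apply: card_le_trans hXk.1 _; apply: card_mem.
move=> u uy; apply: YX; have [sS] := sP _ uy.
by apply: hull_mono => v vs; exists u.
Qed.

Lemma cells : exists Q : V -> V -> V,
  [/\ forall a b, a ∈ P -> b ∈ cof mu ->
        elementary_submodel (Q a b) (H chi) /\ x0 ∈ Q a b /\
        kappa `|` [set kappa] `<=` Q a b /\ card_lt (Q a b) mu,
      forall a b b', a ∈ P -> b ∈ cof mu -> b' ∈ cof mu -> b `<=` b' ->
        Q a b `<=` Q a b',
      forall a, good a -> exists2 b0 : V, b0 ∈ cof mu &
        forall b : V, b ∈ cof mu -> b0 `<=` b ->
          cofinal_in (small_subsets kappa (Q a b) `&` row_union mu Q a)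
                     (small_subsets kappa (Q a b)),
      forall a, a ∈ P -> is_limit a ->
        row_union mu Q a = \bigcup_(d in elts a) row_union mu Q d
    & forall a a', a' ∈ P -> a ∈ a' ->
        row_union mu Q a `<=` row_union mu Q a' /\ row_union mu Q a' a].
Proof.
exists cell; split.
- exact: cell_elementary.
- exact: cell_mono.
- exact: cell_cofinal.
- exact: cell_continuous.
- move=> a a' aP aa; split; last exact: cell_row_mem.
  by apply: cell_row_mono => //; [apply: ord_trans aa aP|apply: mem_sub aa; apply: ord_mem aP].
Qed.

End Construction.

Lemma cof_enum (d : V -> V) (a : V) : is_limit a -> is_limit (d a) ->
  (forall b c, c ∈ a -> b ∈ c -> d b ∈ d c) ->
  (forall b, b ∈ a -> d b ∈ d a) ->
  (forall z, z ∈ d a -> exists2 b, b ∈ a & z ∈ d b) ->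
  cof a `<=` cof (d a).
Proof.
move=> la lda dm da dcof; have [oa _] := la; have [oda _] := lda.
have [_ _ cmin] := cofP oa; have [ocd [f [fda fu]] _] := cofP oda.
have /choice[g gP] : forall i, exists b, i ∈ cof (d a) -> b ∈ a /\ f i ∈ d b.
  by move=> i; have [/fda/dcof[b ba fb]|] := EM (i ∈ cof (d a)); [exists b|exists a].
apply: (cmin _ g) => // [i /gP[]//|x xa].
have [_ [[i ic <-] [fia dxf]]] := fu _ (da _ xa).
have [ga fg] := gP _ ic; exists (g i); split; [by exists i|split=> //].
apply: ord_notin; [exact: ord_mem ga|exact: ord_mem xa|move=> gx].
by have := dxf _ (dm _ _ xa gx); apply: mem_asym.
Qed.

Section JensenOfSquare.
Variables kappa mu : V.
Hypotheses (rk : regular kappa) (cmu : cardinal mu) (kmu : kappa ∈ mu)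
  (cofk : cof mu ∈ kappa).
Let P := succ_cardinal mu.
Let omu := mu_ord cmu.
Let imu := mu_inf rk cmu kmu.
Let oP := succ_mu_ord cmu.
Let ck : cardinal kappa. Proof. by case: rk. Qed.

Lemma cofinal_levels : exists nu : V -> V,
  [/\ forall b, b ∈ cof mu -> nu b ∈ mu /\ kappa ∈ nu b,
      forall b b', b ∈ cof mu -> b' ∈ cof mu -> b `<=` b' -> nu b `<=` nu b'
    & forall z, z ∈ mu -> exists2 b, b ∈ cof mu & z ∈ nu b].
Proof.
have lmu := mu_limit rk cmu kmu; have lc := limit_cof lmu.
have [oc [f [fm fu]] _] := cofP omu.
pose Q b : set V := [set e | kappa ∈ e /\ forall c, c ∈ osucc b -> f c ∈ e].
have Qex b : b ∈ cof mu -> exists2 e, e ∈ mu & Q b e.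
  move=> bc; have sbc := limit_osucc lc bc.
  have [||e em fe] := cof_bounded (A := f @` osucc b) omu sbc.
  - by move=> _ [c cb <-]; apply: fm; apply: ord_trans cb sbc.
  - exact: card_image_le.
  have [e' [em' ee' ke']] := limit_max lmu em kmu.
  exists e' => //; split=> // c cb; apply: ord_trans ee'; first exact: ord_mem em'.
  by apply: fe; exists c.
have Ql b : b ∈ cof mu -> [/\ least (Q b) ∈ mu, Q b (least (Q b))
    & forall e, is_ordinal e -> Q b e -> least (Q b) `<=` e].
  move=> bc; have [e em Qe] := Qex _ bc.
  have [ol Ql lmin] := leastP (ord_mem omu em) Qe.
  by split=> //; apply: ord_le_lt (em) => //; apply: lmin => //; apply: ord_mem em.
exists (fun b => least (Q b)); split.
- by move=> b /Ql[? []].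
- move=> b b' bc bc' bb; have [_ _ lmin] := Ql _ bc; have [lm' [kl fl] _] := Ql _ bc'.
  apply: lmin; first exact: ord_mem lm'.
  split=> // c /osuccP cb; apply: fl; apply/osuccP.
  case: cb => [/bb|->]; first by left.
  by have [] := ord_subE (ord_mem oc bc) (ord_mem oc bc') bb; [left|right].
- move=> z zm; have [_ [[b bc <-] [fbm zf]]] := fu _ zm.
  exists b => //; have [lm [_ fl] _] := Ql _ bc.
  apply: ord_le_lt (ord_mem omu zm) (ord_mem omu lm) zf _.
  by apply: fl; apply: mem_osucc.
Qed.

Lemma small_unbounded (nu : V -> V) (a : V) (A : set V) :
  (forall b, b ∈ cof mu -> nu b ∈ mu) ->
  (forall z, z ∈ mu -> exists2 b, b ∈ cof mu & z ∈ nu b) ->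
  a ∈ P -> kappa `<=` cof a -> unbounded_in A a ->
  exists B : set V, [/\ B `<=` A, unbounded_in B a & exists2 l, l ∈ mu & B #<= l].
Proof.
move=> num nucov aP ka Au; have [oa am] := (mem_succ_cardinal omu a).1 aP.
have [h hP] := card_le_cover am.
have [b bc hb] : exists2 b, b ∈ cof mu & unbounded_in (h @` nu b `&` a) a.
  apply: contrapT => nb.
  have /choice[e eP] : forall b, exists e, b ∈ cof mu ->
      e ∈ a /\ forall i, i ∈ nu b -> h i ∈ a -> h i ∈ e.
    move=> b; have [bc|] := EM (b ∈ cof mu); last by exists b.
    apply: contrapT => ne; apply: nb; exists b => // z za.
    apply: contrapT => nz; apply: ne; exists z => _; split=> // i ib hia.
    apply: contrapT => hz; apply: nz; exists (h i); split; last split=> //.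
      by split=> //; exists i.
    by apply: ord_notin => //; apply: ord_mem oa _.
  have [||z za ez] := @cof_card_lt_bounded a kappa (e @` cof mu) oa ck ka.
  - by move=> _ [b bc <-]; have [] := eP _ bc.
  - exact: card_lt_le ck (card_image_le _ _) (cof_mu_card_lt rk cofk).
  have [i im hi] := hP _ za; have [b bc ib] := nucov _ im.
  have [_ /(_ i ib)] := eP _ bc; rewrite hi => /(_ za).
  by apply: mem_asym; apply: ez; exists b.
have /choice[k kP] : forall y, exists u, y ∈ a -> [/\ A u, u ∈ a & y `<=` u].
  by move=> y; have [/Au[u [Au' [ua yu]]]|] := EM (y ∈ a); [exists u|exists y].
exists (k @` (h @` nu b `&` a)); split.
- by move=> _ [y [_ ya] <-]; have [] := kP _ ya.
- move=> x xa; have [y [[hy ya] [_ xy]]] := hb _ xa; have [_ ka' yk] := kP _ ya.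
  exists (k y); split; first by exists y.
  by split=> //; apply: subset_trans yk.
- exists (nu b); first exact: num.
  apply: card_le_trans (card_image_le _ _) _.
  apply: card_le_trans (card_image_le h _).
  by apply: subset_card_le => y [].
Qed.

Section Square.
Variables (C : V -> V) (D : set V).
Hypothesis clD : club D P.
Hypothesis sqC : forall a : V, D a -> kappa `<=` cof a ->
  C a `<=` a /\ unbounded_in (C a) a /\
  forall x : V, small_subsets kappa (C a) x ->
    exists a' : V, a' ∈ a /\ x `<=` C a' /\ card_lt (C a') kappa.

Lemma square_large (l : V) : kappa ∈ l -> l ∈ mu -> exists e,
  [/\ D e, kappa `<=` cof e & l #<= C e].
Proof.
move=> kl lm; have ol := ord_mem omu lm.
have il : infinite_set l.
  have [_ [ik _]] := rk; apply: infinite_card_le ik; apply: subset_card_le.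
  exact: mem_sub ol kl.
have [cr lr rmin] := succ_cardinalP ol.
have [_ [_ cofr]] := succ_cardinal_regular ol il.
set r := succ_cardinal l in cr lr rmin cofr.
have or_ := cardinal_ord cr.
have rm : r ∈ mu.
  have [//|rE] := ord_subE or_ omu (rmin _ cmu lm).
  by have := cof_mu_mem cmu kmu cofk; rewrite -rE cofr => /mem_irrefl.
have rP : r ∈ P := ord_trans oP rm (mem_succ_mu cmu).
have lr' : is_limit r by apply: cardinal_limit cr _; apply: succ_cardinal_inf ol il.
have [d [dD dm dlim]] := club_enum omu imu clD.
have [ldr dcof] := dlim _ rP lr'; have De := dD _ rP.
have rcof : r `<=` cof (d r).
  rewrite -{1}cofr; apply: cof_enum => // [b c cr' bc|b br].
    by apply: dm => //; apply: ord_trans cr' rP.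
  exact: dm.
have kr : kappa `<=` cof (d r).
  by apply: subset_trans rcof; apply: mem_sub => //; apply: ord_trans kl lr.
exists (d r); split=> //; have [Ce [Cu _]] := sqC De kr.
have [t [ot /card_eqPle[Ct tC]]] := ord_card (C (d r)).
apply: card_le_trans tC; apply: subset_card_le.
apply: ord_notin => // tl; have odr : is_ordinal (d r) by case: ldr.
have [z zd Cz] := cof_bounded odr (rcof _ (ord_trans or_ tl lr)) Ce Ct.
have [y [/Cz yz [_ /(_ _ yz)]]] := Cu _ zd; exact: mem_irrefl.
Qed.

Lemma small_covers (l : V) : kappa ∈ l -> l ∈ mu -> exists ev : V -> V,
  (forall i, i ∈ mu -> ev i `<=` l /\ card_lt (ev i) kappa) /\
  forall w, small_subsets kappa l w -> exists2 i, i ∈ mu & w `<=` ev i.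
Proof.
move=> kl lm; have [e [De ke le]] := square_large kl lm.
(* The covers are pulled back along an injection of [l] into [C e]. *)
have [j [jC j_inj]] := card_le_inj le; have [_ [_ Ccov]] := sqC De ke.
have [_ em] := (mem_succ_cardinal omu e).1 (clD.1 _ De).
have [p pP] := card_le_cover em.
pose A i : set V := [set z | [/\ z ∈ l, card_lt (C (p i)) kappa & j z ∈ C (p i)]].
have sA i : small (A i) by apply: small_sub (small_elts l) => z [].
exists (fun i => mkV (A i)); split=> [i im|w [wl wk]].
  rewrite mkVE //; split; first by move=> z [].
  have [Ck|nC] := EM (card_lt (C (p i)) kappa); last first.
    apply: card_lt_finite ck _ _; first by have [_ []] := rk.
    by apply: (sub_finite_set _ (finite_set0 V)) => z [].
  apply: card_lt_le ck _ Ck; apply: (@inj_card_leP _ _ _ _ j) => [z []//|y z [yl _ _] [zl _ _]].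
  exact: j_inj.
have sw := small_image j w.
have [|a' [ae [wC Ck]]] := Ccov (mkV (j @` w)).
  rewrite /small_subsets /= mkVE //; split; first by move=> _ [z /wl zl <-]; apply: jC.
  exact: card_lt_le ck (card_image_le _ _) wk.
have [i im pi] := pP _ ae; exists i => // z zw; rewrite mkVE // /A /= pi.
split=> //; first exact: wl.
by apply: wC; rewrite mkVE //; exists z.
Qed.

Lemma jensen_of_square_seq chi x : regular chi -> P `<=` chi -> H chi x ->
  exists M, weak_jensen_matrix kappa mu chi x M.
Proof.
move=> rchi Pchi Hx.
have [enk enkP] := enumeration kappa; have [enm enmP] := enumeration mu.
have [nu [nuP nu_mono nu_cov]] := cofinal_levels.
have /choice[ev evP] : forall b, exists ev : V -> V, b ∈ cof mu ->
    (forall i, i ∈ mu -> ev i `<=` nu b /\ card_lt (ev i) kappa) /\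
    forall w, small_subsets kappa (nu b) w -> exists2 i, i ∈ mu & w `<=` ev i.
  move=> b; have [/nuP[bm kb]|] := EM (b ∈ cof mu); last by exists id.
  by have [ev evP] := small_covers kb bm; exists ev.
pose good a := D a /\ kappa `<=` cof a.
have /choice[K KP] : forall a, exists B : set V, good a ->
    [/\ B `<=` C a, unbounded_in B a & exists2 l, l ∈ mu & B #<= l].
  move=> a; have [[Da ka]|] := EM (good a); last by exists set0.
  have [_ [Cu _]] := sqC Da ka.
  have [|B BP] := small_unbounded _ nu_cov (clD.1 _ Da) ka Cu; last by exists B.
  by move=> b /nuP[].
have [||||||||Q [Q1 Q2 Q3 Q4 Q5]] := @cells kappa mu rk cmu kmu cofk chi x rchi Pchi Hx enk enm
  enkP enmP C K good nu ev.
- move=> a ga; have [Da ka] := ga; have [Ca [_ _]] := sqC Da ka.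
  by have [KC Ku _] := KP _ ga; split=> //; apply: clD.1.
- by move=> a /KP[].
- move=> a w [Da ka] wC; have [_ [_ /(_ _ wC)[a' [? [? ?]]]]] := sqC Da ka.
  by exists a'.
- exact: nuP.
- exact: nu_mono.
- exact: nu_cov.
- by move=> b i bc im; have [/(_ i im)] := evP _ bc.
- by move=> b w bc; have [_] := evP _ bc; apply.
have [d [dD dm dlim]] := club_enum omu imu clD.
have dP a : a ∈ P -> d a ∈ P by move=> /dD; apply: clD.1.
have row a b : a ∈ P -> b ∈ P -> a ∈ b -> row_union mu Q (d a) `<=` row_union mu Q (d b).
  by move=> aP bP ab; have [] := Q5 _ _ (dP _ bP) (dm _ _ bP ab).
exists (fun a b => Q (d a) b); split.
- by move=> a b aP bc; apply: Q1 => //; apply: dP.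
- by move=> a b b' aP; apply: Q2; apply: dP.
- move=> a aP ka; apply: Q3; split; first exact: dD.
  have la : is_limit a.
    by have [_ [ik _]] := rk; apply: cof_limit ck ik ka; apply: ord_mem aP.
  have [lda dcof] := dlim _ aP la.
  apply: (subset_trans ka); apply: cof_enum => // [b c ca bc|b ba]; apply: dm => //.
  exact: ord_trans ca aP.
split.
- move=> a a' aP aP' aa.
  by have [/row|->//] := ord_subE (ord_mem oP aP) (ord_mem oP aP') aa; apply.
- move=> a aP la; have [lda dcof] := dlim _ aP la.
  rewrite /row_union -/(row_union mu Q (d a)) Q4 //; last exact: dP.
  apply/seteqP; split=> y.
    move=> [z zd yz]; have [b ba zb] := dcof _ zd; exists b => //.
    have bP : b ∈ P := ord_trans oP ba aP.
    by have [+ _] := Q5 _ _ (dP _ bP) zb; apply.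
  by move=> [b ba yb]; exists (d b) => //; apply: dm.
- move=> a aP.
  have ad b : b ∈ P -> b `<=` d b.
    elim: (mem_wf b) => {}b _ IH bP c cb; have cP := ord_trans oP cb bP.
    apply: ord_le_lt (IH _ cb cP) (dm _ _ bP cb); first exact: ord_mem cP.
    by apply: ord_mem oP _; apply: dP.
  have sP : osucc a ∈ P by apply: limit_osucc aP; apply: cardinal_limit (succ_mu_cardinal cmu) (succ_cardinal_inf omu imu).
  exists (osucc a) => //.
  have ads : a ∈ d (osucc a) by apply: ad => //; apply: mem_osucc.
  by have [] := Q5 _ _ (dP _ sP) ads.
Qed.

End Square.

Lemma jensen_of_square chi x : weak_square kappa mu ->
  regular chi -> P `<=` chi -> H chi x -> exists M, weak_jensen_matrix kappa mu chi x M.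
Proof. by move=> [C [D [clD sqC]]]; exact: (jensen_of_square_seq clD sqC). Qed.

Lemma regular_above (c : V) : cardinal c ->
  exists chi : V, [/\ regular chi, c `<=` chi, P `<=` chi & H chi mu].
Proof.
move=> cc; have oc := cardinal_ord cc.
have [e [oe ce Pe]] : exists e, [/\ is_ordinal e, c `<=` e & P `<=` e].
  have [cP|cP] := EM (c ∈ P).
    by exists P; split=> //; apply: mem_sub.
  by exists c; split=> //; apply: ord_notin.
have ie : infinite_set e.
  by apply: infinite_card_le (succ_cardinal_inf omu imu); apply: subset_card_le.
have [cs es _] := succ_cardinalP oe; have os := cardinal_ord cs.
have rs := succ_cardinal_regular oe ie.
have Ps : P `<=` succ_cardinal e := subset_trans Pe (mem_sub os es).
exists (succ_cardinal e); split=> //; first exact: subset_trans ce (mem_sub os es).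
by apply: H_ordinal => //; apply: Ps; apply: mem_succ_mu.
Qed.

End JensenOfSquare.

Theorem theorem2p6 (kappa mu : V) :
  regular kappa -> cardinal mu -> kappa ∈ mu -> cof mu ∈ kappa ->
  (weak_square kappa mu <->
     exists chi x : V, regular chi /\ H chi x /\
       exists M : V -> V -> V, weak_jensen_matrix kappa mu chi x M)
  /\
  ((exists chi x : V, regular chi /\ H chi x /\
      exists M : V -> V -> V, weak_jensen_matrix kappa mu chi x M) <->
   (exists chi0 : V, cardinal chi0 /\
      forall chi : V, regular chi -> chi0 `<=` chi ->
      forall x : V, H chi x ->
        exists M : V -> V -> V, weak_jensen_matrix kappa mu chi x M)).
Proof.
move=> rk cmu kmu cofk.
have sq_all : weak_square kappa mu -> exists chi0 : V, cardinal chi0 /\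
    forall chi : V, regular chi -> chi0 `<=` chi -> forall x : V, H chi x ->
      exists M : V -> V -> V, weak_jensen_matrix kappa mu chi x M.
  move=> sq; exists (succ_cardinal mu); split; first exact: succ_mu_cardinal.
  by move=> chi rchi Pchi x; apply: jensen_of_square.
have ex_sq : (exists chi x : V, regular chi /\ H chi x /\
    exists M : V -> V -> V, weak_jensen_matrix kappa mu chi x M) -> weak_square kappa mu.
  by move=> [chi [x [_ [_ [M /square_of_jensen]]]]]; apply.
have all_ex : (exists chi0 : V, cardinal chi0 /\
    forall chi : V, regular chi -> chi0 `<=` chi -> forall x : V, H chi x ->
      exists M : V -> V -> V, weak_jensen_matrix kappa mu chi x M) ->
    exists chi x : V, regular chi /\ H chi x /\
      exists M : V -> V -> V, weak_jensen_matrix kappa mu chi x M.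
  move=> [chi0 [cchi0 all]].
  have [chi [rchi chi0s _ Hmu]] := regular_above rk cmu kmu cchi0.
  by exists chi, mu; split=> //; split=> //; apply: all.
by split; split; [move=> /sq_all/all_ex|exact: ex_sq|move=> /ex_sq/sq_all|exact: all_ex].
Qed.
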